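(* Under the standing assumptions of the context, as $l\to\infty$, $$|\Delta^2_{\widehat{\varphi_l^{\bot}}}-\Delta^2_{\widehat{\varphi^M}}|=O\Big(\max\big\{\mu(l),\,(4e^{2\omega_0})^{-2l+4\log_2\frac{1+\varepsilon(l)}{c}}\big\}\Big).$$
   Context: Fourier transform: $\widehat f(\omega)=\int_{\mathbb{R}}f(t)e^{-it\omega}\,dt$. Let $\theta$ be odd, non-decreasing, $C^2$, with $\theta(\omega)=\pi/4$ for $\omega>\pi/3$; fix $\pi/3\le\omega_0<\pi/2$. Meyer scaling function: $\widehat{\varphi^M}(\omega)=1$ for $|\omega|\le2\omega_0$, $=\cos(\frac\pi4+\theta(\frac{\pi}{3(\pi-2\omega_0)}(|\omega|-\pi)))$ for $2\omega_0<|\omega|\le2\pi-2\omega_0$, $=0$ otherwise. Meyer mask: $2\pi$-periodic $m^M$ with $m^M(\omega)=\widehat{\varphi^M}(2\omega)$ on $[-\pi,\pi]$. $\|\cdot\|_C$: sup norm on $[-\pi,\pi]$. A linear method of summation $(\lambda_{n,k})$ maps $f$ with Fourier coefficients $a_k,b_k$ to $u_n(f,\omega)=\frac{a_0}2+\sum_{k=1}^n\lambda_{n,k}(a_k\cos k\omega+b_k\sin k\omega)$. $m^M_l:=m^M/(\cos\frac\omega2)^{2l}$. Standing assumptions: a method $(\lambda_{n,k})$ and sequence $n(l)$ are fixed with $u_l:=u_{n(l)}(m^M_l,\cdot)$, $u_{1,l}:=u_{n(l)}((m^M_l)',\cdot)$ satisfying $\alpha(l):=\|u_l-m^M_l\|_C=o(l^{-1})$,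 $\gamma(l):=\|u_{1,l}-(m^M_l)'\|_C=o(1)$, $u_l(\pi)\ne0$; $l_0$ is fixed with $c:=\inf_{l\ge l_0}|u_l(0)|>0$ and $l\ge l_0$. $\varepsilon(l):=\alpha(l)/\|m^M_l\|_C$, $\mu(l):=l\alpha(l)+\gamma(l)$. $m_l(\omega):=(\cos\frac\omega2)^{2l}u_l(\omega)/u_l(0)$, $\widehat{\varphi_l}(\omega):=\prod_{j\ge1}m_l(\omega2^{-j})$, $\Phi_l(\omega):=\sum_{k\in\mathbb{Z}}|\widehat{\varphi_l}(\omega+2\pi k)|^2$, $\widehat{\varphi_l^{\bot}}:=\widehat{\varphi_l}\Phi_l^{-1/2}$. Frequency radius: $\Delta^2_{\widehat f}=\|\widehat f\|_{L^2}^{-2}\int(\omega-\omega_{0\widehat f})^2|\widehat f(\omega)|^2d\omega$ with $\omega_{0\widehat f}=\|\widehat f\|_{L^2}^{-2}\int\omega|\widehat f(\omega)|^2d\omega$. *)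

(* Defs.v *)
From Stdlib Require Import Reals.
From Coquelicot Require Import Coquelicot.
Open Scope R_scope.

Definition odd_fun (f : R -> R) : Prop := forall x, f (- x) = - f x.
Definition nondecr (f : R -> R) : Prop := forall x y, x <= y -> f x <= f y.
Definition C2fun (f : R -> R) : Prop :=
  forall x, ex_derive f x /\ ex_derive (Derive f) x /\ continuous (Derive (Derive f)) x.

Definition meyer_phi_hat (theta : R -> R) (w0 w : R) : R :=
  if Rle_dec (Rabs w) (2 * w0) then 1
  else if Rle_dec (Rabs w) (2 * PI - 2 * w0) then
    cos (PI / 4 + theta (PI / (3 * (PI - 2 * w0)) * (Rabs w - PI)))
  else 0.

Definition red2pi (w : R) : R := w - 2 * PI * IZR (Int_part ((w + PI) / (2 * PI))).

Definition meyer_mask theta w0 (w : R) : R := meyer_phi_hat theta w0 (2 * red2pi w).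

Definition supC (f : R -> R) : R :=
  real (Lub_Rbar (fun y => exists x, - PI <= x <= PI /\ y = Rabs (f x))).

Definition four_a (f : R -> R) (k : nat) : R :=
  / PI * RInt (fun t => f t * cos (INR k * t)) (- PI) PI.
Definition four_b (f : R -> R) (k : nat) : R :=
  / PI * RInt (fun t => f t * sin (INR k * t)) (- PI) PI.

Definition usum (lam : nat -> nat -> R) (n : nat) (f : R -> R) (w : R) : R :=
  four_a f 0 / 2 +
  sum_n_m (fun k => lam n k * (four_a f k * cos (INR k * w) + four_b f k * sin (INR k * w))) 1 n.

Section Construction.
Variables (theta : R -> R) (w0 : R) (lam : nat -> nat -> R) (nl : nat -> nat) (l0 : nat).

Definition mMl (l : nat) (w : R) : R := meyer_mask theta w0 w / (cos (w / 2)) ^ (2 * l).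
Definition ul (l : nat) : R -> R := usum lam (nl l) (mMl l).
Definition u1l (l : nat) : R -> R := usum lam (nl l) (Derive (mMl l)).
Definition alpha (l : nat) : R := supC (fun w => ul l w - mMl l w).
Definition gamma (l : nat) : R := supC (fun w => u1l l w - Derive (mMl l) w).
Definition eps (l : nat) : R := alpha l / supC (mMl l).
Definition mu (l : nat) : R := INR l * alpha l + gamma l.
Definition cinf : Rbar := Glb_Rbar (fun y => exists l, (l0 <= l)%nat /\ y = Rabs (ul l 0)).

Definition ml (l : nat) (w : R) : R := (cos (w / 2)) ^ (2 * l) * ul l w / ul l 0.

Fixpoint pprod (f : nat -> R) (N : nat) : R :=
  match N with O => 1 | S n => pprod f n * f (S n) end.

Definition phil_hat (l : nat) (w : R) : R :=
  real (Lim_seq (fun N => pprod (fun j => ml l (w / 2 ^ j)) N)).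

(** sum over k in Z of |phil_hat(w + 2 pi k)|^2 *)
Definition Phil (l : nat) (w : R) : R :=
  Series (fun k => (phil_hat l (w + 2 * PI * INR k)) ^ 2)
  + Series (fun k => (phil_hat l (w - 2 * PI * INR (S k))) ^ 2).

Definition phil_perp_hat (l : nat) (w : R) : R := phil_hat l w / sqrt (Phil l w).

End Construction.

Definition RIntR (f : R -> R) : R := RInt_gen f (Rbar_locally m_infty) (Rbar_locally p_infty).

Definition L2sq (f : R -> R) : R := RIntR (fun w => (Rabs (f w)) ^ 2).
Definition freq_center (f : R -> R) : R := / L2sq f * RIntR (fun w => w * (Rabs (f w)) ^ 2).
Definition freq_radius2 (f : R -> R) : R :=
  / L2sq f * RIntR (fun w => (w - freq_center f) ^ 2 * (Rabs (f w)) ^ 2).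

(* Main.v *)
Require Import Defs.
From Stdlib Require Import Reals ZArith Lra Lia.
From Coquelicot Require Import Coquelicot.
Open Scope R_scope.

(** The error is already [O(mu)].  Since
    [m_l 0 = 1] and the derivative of [u_l] is [u_{1,l}], the mean value theorem
    gives [|m_l w - m^M w| <= 4 mu |w|], so the infinite products differ by
    [O(mu)] on [[-2 pi, 2 pi]].  For large [w], put [t = sin^2 (x/2)], so that
    doubling [x] acts on [t] as the logistic map [t -> 4 t (1 - t)].  The Meyer mask
    vanishes for [t >= tau := (1 + cos w0) / 2], where therefore
    [|m_l| <= 2 alpha (1 - t)^l], while outside this window [t] grows under
    doubling.  A weight on [t] combines both facts into
    [|m_l x| W x <= W (2 x) / 4], and the first passage through the window yields the
    factor [alpha]: [phi_l w = O(alpha / (1 + w^2))].  Hence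
    [|phi_l - phi^M| = O(mu / (1 + w^2))] on the whole line.  Periodizing gives
    [Phi_l = 1 + O(mu)], the moments of order 0, 1, 2 of the squares differ by
    [O(mu)], and the squared radius is [M2 / M0 - (M1 / M0)^2]. *)

(** * Improper integrals of functions that decay like 1/(1+x^2) *)

(** The second moment forces [phi_l] to decay like $w^{-2}$, whereas away from the window only
    $|m_l|\le2$ is available, so a direct estimate of the product grows at every octave. Hence the
    exponent 3 in the weight: a step outside the window gains $(9/4)^3>8$, which pays for the factor
    2 and still leaves $1/4$ per octave, that is $w^{-2}$. The opposite danger is a window point
    near $\pi$: doubling throws it next to 0 modulo $2\pi$, where the weight is tiny. There the zero
    of $\cos(x/2)^{2l}$ supplies $(1-t)^3$ as soon as $l\ge3$, which is the amount lost. Near the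
    origin a merely uniform bound on $m_l-m^M$ would not be summable over the factors
    $m_l(w2^{-j})$; a bound that vanishes linearly at 0 is, and this is why control of the
    derivative enters. Orthonormality of the Meyer translates makes their periodization exactly 1,
    so the division by $\Phi_l$ only perturbs at order $\mu$. *)

Lemma one_plus_sq_pos x : 0 < 1 + x ^ 2.
Proof. pose proof (pow2_ge_0 x). lra. Qed.

Lemma atan_le x y : x <= y -> atan x <= atan y.
Proof.
  intros [H|H]; [left; now apply atan_increasing|subst; apply Rle_refl].
Qed.

Lemma atan_tail_small eps : 0 < eps ->
  exists A, 1 <= A /\ (forall x, A <= x -> PI / 2 - atan x < eps)
    /\ (forall x, x <= - A -> atan x + PI / 2 < eps).
Proof.
  intros He. pose proof PI_RGT_0 as Hpi. pose proof PI2_1 as HP.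
  (* Capped at 1 so that $\pi/2-e$ stays where [atan] inverts [tan]. *)
  set (e := Rmin (eps / 2) 1).
  assert (0 < e) by (apply Rmin_pos; lra).
  assert (e <= eps / 2) by apply Rmin_l.
  assert (e <= 1) by apply Rmin_r.
  exists (Rmax 1 (tan (PI / 2 - e))).
  assert (K : forall x, Rmax 1 (tan (PI / 2 - e)) <= x -> PI / 2 - atan x < eps).
  { intros x Hx. assert (tan (PI / 2 - e) <= x) as Ht.
    { eapply Rle_trans; [apply Rmax_r|exact Hx]. }
    apply atan_le in Ht. rewrite atan_tan in Ht; lra. }
  split; [apply Rmax_l|split; [exact K|]].
  intros x Hx. specialize (K (- x)). rewrite atan_opp in K. lra.
Qed.

Lemma is_RInt_inv_one_plus_sq B a b :
  is_RInt (fun x => B / (1 + x ^ 2)) a b (B * atan b - B * atan a).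
Proof.
  apply (is_RInt_derive (fun x => B * atan x) (fun x => B / (1 + x ^ 2))).
  - intros x _. auto_derive; [trivial|]. unfold Rsqr.
    pose proof (one_plus_sq_pos x). field. lra.
  - intros x _. apply (ex_derive_continuous (fun x => B / (1 + x ^ 2))).
    auto_derive. pose proof (one_plus_sq_pos x). lra.
Qed.

Lemma ex_RInt_of_continuous (g : R -> R) a b :
  (forall x, continuous g x) -> ex_RInt g a b.
Proof. intros H. apply (ex_RInt_continuous (V := R_CompleteNormedModule)). auto. Qed.

Lemma abs_RInt_le_atan g B a b :
  (forall x, continuous g x) -> (forall x, Rabs (g x) <= B / (1 + x ^ 2)) ->
  a <= b -> Rabs (RInt g a b) <= B * (atan b - atan a).
Proof.
  intros Hc Hb Hab.
  eapply Rle_trans; [apply abs_RInt_le; [exact Hab|now apply ex_RInt_of_continuous]|].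
  replace (B * (atan b - atan a)) with (RInt (fun x => B / (1 + x ^ 2)) a b).
  2:{ apply is_RInt_unique. replace (B * (atan b - atan a)) with (B * atan b - B * atan a) by ring.
      apply is_RInt_inv_one_plus_sq. }
  apply RInt_le; [exact Hab| | |].
  - apply ex_RInt_of_continuous. intros x. apply continuous_Rabs_comp. apply Hc.
  - eexists. apply is_RInt_inv_one_plus_sq.
  - intros; apply Hb.
Qed.

Lemma abs_RInt_le_atan_abs g B a b :
  (forall x, continuous g x) -> (forall x, Rabs (g x) <= B / (1 + x ^ 2)) ->
  Rabs (RInt g a b) <= B * Rabs (atan b - atan a).
Proof.
  intros Hc Hb. destruct (Rle_dec a b) as [H|H].
  - rewrite (Rabs_pos_eq (_ - _)).
    + now apply abs_RInt_le_atan.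
    + apply atan_le in H. lra.
  - rewrite <- opp_RInt_swap by now apply ex_RInt_of_continuous.
    unfold opp; simpl. rewrite Rabs_Ropp, Rabs_minus_sym, (Rabs_pos_eq (_ - _)).
    + apply abs_RInt_le_atan; auto. lra.
    + assert (b <= a) as H' by lra. apply atan_le in H'. lra.
Qed.

Local Notation is_RIntR f l :=
  (@is_RInt_gen R_NormedModule f (Rbar_locally m_infty) (Rbar_locally p_infty) l).

Lemma RIntR_unique f l : is_RIntR f l -> RIntR f = l.
Proof. intros H. apply is_RInt_gen_unique. exact H. Qed.

Lemma filter_prod_infty A (P : R * R -> Prop) :
  (forall a b, a < - A -> A < b -> P (a, b)) ->
  filter_prod (Rbar_locally m_infty) (Rbar_locally p_infty) P.
Proof.
  intros H.
  apply Filter_prod with (Q := fun a => a < - A) (R := fun b => A < b).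
  - now exists (- A).
  - now exists A.
  - exact H.
Qed.

(** Cauchy criterion along the product filter: moving the endpoints changes the integral by two end
    pieces, each dominated by an increment of [B * atan] near $\pm\pi/2$. *)
Lemma ex_RIntR_decay g B :
  (forall x, continuous g x) -> (forall x, Rabs (g x) <= B / (1 + x ^ 2)) ->
  exists l, is_RIntR g l.
Proof.
  intros Hc Hb.
  assert (HB : 0 <= B).
  { specialize (Hb 0). pose proof (Rabs_pos (g 0)).
    replace (B / (1 + 0 ^ 2)) with B in Hb by field. lra. }
  set (F := filter_prod (Rbar_locally m_infty) (Rbar_locally p_infty)).
  assert (exists y : R, filterlim (fun ab : R * R => RInt g (fst ab) (snd ab)) F (locally y))
    as [y Hy].
  { apply (proj1 (filterlim_locally_cauchy (F := F)
       (fun ab : R * R => RInt g (fst ab) (snd ab)))).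
    intros eps.
    (* [B + 1] instead of [B], which may be 0. *)
    destruct (atan_tail_small (eps / (2 * (B + 1)))) as [A [HA1 [HA2 HA3]]].
    { apply Rdiv_lt_0_compat; [apply eps|lra]. }
    exists (fun ab => fst ab < - A /\ A < snd ab). split.
    { apply filter_prod_infty with A. simpl. auto. }
    intros [a b] [a' b'] [H1 H2] [H3 H4]. simpl in *.
    change (Rabs (RInt g a' b' - RInt g a b) < eps).
    assert (E : RInt g a' b' = RInt g a' a + RInt g a b + RInt g b b').
    { rewrite <- (RInt_Chasles g a' b b') by now apply ex_RInt_of_continuous.
      rewrite <- (RInt_Chasles g a' a b) by now apply ex_RInt_of_continuous.
      reflexivity. }
    rewrite E.
    replace (RInt g a' a + RInt g a b + RInt g b b' - RInt g a b)
      with (RInt g a' a + RInt g b b') by ring.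
    eapply Rle_lt_trans; [apply Rabs_triang|].
    pose proof (abs_RInt_le_atan_abs g B a' a Hc Hb) as G1.
    pose proof (abs_RInt_le_atan_abs g B b b' Hc Hb) as G2.
    set (d := eps / (2 * (B + 1))) in *.
    assert (Hd : 2 * (B + 1) * d = eps) by (unfold d; field; lra).
    assert (D1 : Rabs (atan a - atan a') <= d).
    { pose proof (HA3 a ltac:(lra)). pose proof (HA3 a' ltac:(lra)).
      pose proof (atan_bound a). pose proof (atan_bound a').
      apply Rabs_le. lra. }
    assert (D2 : Rabs (atan b' - atan b) <= d).
    { pose proof (HA2 b ltac:(lra)). pose proof (HA2 b' ltac:(lra)).
      pose proof (atan_bound b). pose proof (atan_bound b').
      apply Rabs_le. lra. }
    pose proof (Rmult_le_compat_l B _ _ HB D1).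
    pose proof (Rmult_le_compat_l B _ _ HB D2).
    pose proof (cond_pos eps).
    nra. }
  exists y. intros P HP. specialize (Hy P HP).
  unfold filtermap, filtermapi in *.
  eapply filter_imp; [|exact Hy].
  intros [a b] Hab. exists (RInt g a b). split; [|exact Hab].
  apply (RInt_correct (V := R_CompleteNormedModule)). now apply ex_RInt_of_continuous.
Qed.

(** The limit only sees wide intervals, so bounds valid on those containing $[-1,1]$ suffice; this
    allows a lower bound that comes from a fixed central piece. *)
Lemma is_RIntR_between g l lo hi :
  (forall a b, a <= -1 -> 1 <= b -> lo <= RInt g a b <= hi) ->
  is_RIntR g l -> lo <= l <= hi.
Proof.
  intros Hb Hl.
  assert (K : forall eps : posreal, exists v, lo <= v <= hi /\ Rabs (v - l) < eps).
  { intros eps. specialize (Hl (ball l eps) (locally_ball l eps)).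
    unfold filtermapi in Hl. destruct Hl as [Q R0 [M1 HQ] [M2 HR] H].
    set (a := Rmin (M1 - 1) (-1)). set (b := Rmax (M2 + 1) 1).
    destruct (H a b) as [v [Hv1 Hv2]].
    - apply HQ. unfold a. pose proof (Rmin_l (M1 - 1) (-1)). lra.
    - apply HR. unfold b. pose proof (Rmax_l (M2 + 1) 1). lra.
    - exists v. split; [|exact Hv2].
      apply (is_RInt_unique (V := R_CompleteNormedModule)) in Hv1. simpl in Hv1. rewrite <- Hv1. apply Hb.
      + apply Rmin_r.
      + apply Rmax_r. }
  split; apply Rnot_lt_le; intros Hlt.
  - destruct (K (mkposreal (lo - l) ltac:(lra))) as [v [Hv1 Hv2]]. simpl in Hv2.
    apply Rabs_def2 in Hv2. lra.
  - destruct (K (mkposreal (l - hi) ltac:(lra))) as [v [Hv1 Hv2]]. simpl in Hv2.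
    apply Rabs_def2 in Hv2. lra.
Qed.

Lemma is_RIntR_decay_bound g B l :
  (forall x, continuous g x) -> (forall x, Rabs (g x) <= B / (1 + x ^ 2)) ->
  is_RIntR g l -> Rabs l <= B * PI.
Proof.
  intros Hc Hb Hl. apply Rabs_le.
  apply (is_RIntR_between g l); [|exact Hl].
  intros a b Ha Hb'. apply Rabs_le_between.
  eapply Rle_trans; [apply (abs_RInt_le_atan g B); auto; lra|].
  assert (HB : 0 <= B).
  { specialize (Hb 0). pose proof (Rabs_pos (g 0)).
    replace (B / (1 + 0 ^ 2)) with B in Hb by field. lra. }
  apply Rmult_le_compat_l; [exact HB|].
  pose proof (atan_bound a). pose proof (atan_bound b). lra.
Qed.

(** * Stability of the frequency radius *)

(** The variance identity, from expanding $(w-m_1/m_0)^2$ under the integral. *)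
Lemma freq_radius2_moments f m0 m1 m2 : m0 <> 0 ->
  is_RIntR (fun w => Rabs (f w) ^ 2) m0 ->
  is_RIntR (fun w => w * Rabs (f w) ^ 2) m1 ->
  is_RIntR (fun w => w ^ 2 * Rabs (f w) ^ 2) m2 ->
  freq_radius2 f = m2 / m0 - (m1 / m0) ^ 2.
Proof.
  intros Hm H0 H1 H2. unfold freq_radius2.
  assert (Hc : freq_center f = m1 / m0).
  { unfold freq_center, L2sq. rewrite (RIntR_unique _ _ H0), (RIntR_unique _ _ H1).
    field. exact Hm. }
  rewrite Hc. unfold L2sq. rewrite (RIntR_unique _ _ H0).
  set (c := m1 / m0).
  rewrite (RIntR_unique (fun w => (w - c) ^ 2 * Rabs (f w) ^ 2)
             (m2 + ((- 2 * c) * m1 + c ^ 2 * m0))).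
  - unfold c. field. exact Hm.
  - pose proof (is_RInt_gen_plus _ _ _ _ H2
      (is_RInt_gen_plus _ _ _ _ (is_RInt_gen_scal _ (- 2 * c) _ H1)
         (is_RInt_gen_scal _ (c ^ 2) _ H0))) as H.
    eapply is_RInt_gen_ext; [|exact H].
    apply filter_prod_infty with 0. intros a b _ _ x _.
    unfold plus, scal; simpl; unfold mult; simpl. ring.
Qed.

(** The condition [e <= b' / 2] keeps [b] above half of [b'], whence the factor 2. *)
Lemma quotient_stable a b a' b' e :
  0 < b' -> e <= b' / 2 -> Rabs (a - a') <= e -> Rabs (b - b') <= e ->
  Rabs (a / b - a' / b') <= e * (2 * (b' + Rabs a') / b' ^ 2).
Proof.
  intros Hb He Ha Hb'.
  assert (Hbb : b' / 2 <= b) by (apply Rabs_le_between in Hb'; lra).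
  replace (a / b - a' / b') with (((a - a') * b' + a' * (b' - b)) / (b * b'))
    by (field; lra).
  unfold Rdiv at 1. rewrite Rabs_mult.
  assert (N : Rabs ((a - a') * b' + a' * (b' - b)) <= e * (b' + Rabs a')).
  { eapply Rle_trans; [apply Rabs_triang|]. rewrite !Rabs_mult, (Rabs_pos_eq b') by lra.
    rewrite (Rabs_minus_sym b' b). pose proof (Rabs_pos a'). nra. }
  assert (D : Rabs (/ (b * b')) <= 2 / b' ^ 2).
  { rewrite Rabs_pos_eq.
    - replace (2 / b' ^ 2) with (/ (b' / 2 * b')) by (field; lra).
      apply Rinv_le_contravar; [apply Rmult_lt_0_compat; lra|].
      apply Rmult_le_compat_r; lra.
    - left. apply Rinv_0_lt_compat. apply Rmult_lt_0_compat; lra. }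
  replace (e * (2 * (b' + Rabs a') / b' ^ 2)) with (e * (b' + Rabs a') * (2 / b' ^ 2))
    by (field; lra).
  apply Rmult_le_compat; auto using Rabs_pos.
Qed.

Lemma sqr_stable x y d D : Rabs (x - y) <= d -> d <= D ->
  Rabs (x ^ 2 - y ^ 2) <= d * (2 * Rabs y + D).
Proof.
  intros H HD. replace (x ^ 2 - y ^ 2) with ((x - y) * ((x - y) + 2 * y)) by ring.
  rewrite Rabs_mult. apply Rmult_le_compat; auto using Rabs_pos.
  eapply Rle_trans; [apply Rabs_triang|]. rewrite Rabs_mult, (Rabs_pos_eq 2) by lra. lra.
Qed.

Lemma decay_mult q h d w :
  Rabs q <= 1 + w ^ 2 -> Rabs h <= d / (1 + w ^ 2) ^ 2 ->
  Rabs (q * h) <= d / (1 + w ^ 2).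
Proof.
  intros Hq Hh. rewrite Rabs_mult. pose proof (one_plus_sq_pos w) as Hw.
  replace (d / (1 + w ^ 2)) with ((1 + w ^ 2) * (d / (1 + w ^ 2) ^ 2)) by (field; lra).
  apply Rmult_le_compat; auto using Rabs_pos.
Qed.

Lemma abs_le_one_plus_sq w : Rabs w <= 1 + w ^ 2.
Proof. apply Rabs_le. split; nra. Qed.

Lemma pow2_le_one_plus_sq w : Rabs (w ^ 2) <= 1 + w ^ 2.
Proof. rewrite Rabs_pos_eq; [lra|apply pow2_ge_0]. Qed.

Lemma one_le_one_plus_sq w : Rabs 1 <= 1 + w ^ 2.
Proof. rewrite Rabs_R1. pose proof (pow2_ge_0 w). lra. Qed.

(** Decay of order $(1+w^2)^{-2}$ absorbs a factor $q$ of size $1+w^2$ and leaves an integrable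
    majorant, so $q=1,w,w^2$ are treated at once. The new integral is obtained as that of $qG$ plus
    that of the difference. *)
Lemma moment_stable (q F G : R -> R) B d :
  (forall w, continuous q w) -> (forall w, Rabs (q w) <= 1 + w ^ 2) ->
  (forall w, continuous F w) -> (forall w, continuous G w) ->
  (forall w, Rabs (G w) <= B / (1 + w ^ 2) ^ 2) ->
  (forall w, Rabs (F w - G w) <= d / (1 + w ^ 2) ^ 2) ->
  exists n, is_RIntR (fun w => q w * F w) n /\
    Rabs (n - RIntR (fun w => q w * G w)) <= d * PI.
Proof.
  intros Hq Hqb HF HG HGb HFG.
  destruct (ex_RIntR_decay (fun w : R => q w * G w) B) as [m Hm].
  { intros w. apply (continuous_mult q G); auto. }
  { intros w. apply decay_mult; auto. }
  assert (Hdc : forall w, continuous (fun w => q w * (F w - G w)) w).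
  { intros w. apply (continuous_mult q); auto.
    apply (continuous_minus F G); auto. }
  assert (Hdb : forall w, Rabs (q w * (F w - G w)) <= d / (1 + w ^ 2)).
  { intros w. apply decay_mult; auto. }
  destruct (ex_RIntR_decay (fun w : R => q w * (F w - G w)) d Hdc Hdb) as [e He].
  exists (m + e). split.
  - eapply is_RInt_gen_ext; [|exact (is_RInt_gen_plus _ _ _ _ Hm He)].
    apply filter_prod_infty with 0. intros a b _ _ x _. unfold plus; simpl. ring.
  - rewrite (RIntR_unique _ _ Hm). replace (m + e - m) with e by (simpl in *; lra).
    eapply is_RIntR_decay_bound; eauto.
Qed.

Lemma is_RIntR_ext f g l : (forall w, f w = g w) -> is_RIntR f l -> is_RIntR g l.
Proof.
  intros H Hl. eapply is_RInt_gen_ext; [|exact Hl].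
  apply filter_prod_infty with 0. intros a b _ _ x _. apply H.
Qed.

(** The squared radius is a rational function of three moments, each displaced by at most $d\pi$;
    its denominator stays away from 0 while $d\pi\le m_0/2$, which fixes [delta]. *)
Lemma freq_radius2_stable (f0 : R -> R) B :
  (forall w, continuous (fun w => Rabs (f0 w) ^ 2) w) ->
  (forall w, Rabs (f0 w) ^ 2 <= B / (1 + w ^ 2) ^ 2) ->
  0 < L2sq f0 ->
  exists K delta, 0 <= K /\ 0 < delta /\ forall f d, d <= delta ->
    (forall w, continuous (fun w => Rabs (f w) ^ 2) w) ->
    (forall w, Rabs (Rabs (f w) ^ 2 - Rabs (f0 w) ^ 2) <= d / (1 + w ^ 2) ^ 2) ->
    Rabs (freq_radius2 f - freq_radius2 f0) <= K * d.
Proof.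
  intros Hc0 Hb0 Hpos.
  assert (Hb0' : forall w, Rabs (Rabs (f0 w) ^ 2) <= B / (1 + w ^ 2) ^ 2).
  { intros w. rewrite Rabs_pos_eq by apply pow2_ge_0. apply Hb0. }
  assert (Mom : forall f d,
    (forall w, continuous (fun w => Rabs (f w) ^ 2) w) ->
    (forall w, Rabs (Rabs (f w) ^ 2 - Rabs (f0 w) ^ 2) <= d / (1 + w ^ 2) ^ 2) ->
    exists n0 n1 n2, is_RIntR (fun w => Rabs (f w) ^ 2) n0 /\
      is_RIntR (fun w => w * Rabs (f w) ^ 2) n1 /\
      is_RIntR (fun w => w ^ 2 * Rabs (f w) ^ 2) n2 /\
      Rabs (n0 - RIntR (fun w => 1 * Rabs (f0 w) ^ 2)) <= d * PI /\
      Rabs (n1 - RIntR (fun w => w * Rabs (f0 w) ^ 2)) <= d * PI /\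
      Rabs (n2 - RIntR (fun w => w ^ 2 * Rabs (f0 w) ^ 2)) <= d * PI).
  { intros f d Hc Hd.
    destruct (moment_stable (fun _ => 1) (fun w => Rabs (f w) ^ 2)
      (fun w => Rabs (f0 w) ^ 2) B d) as [n0 [I0 J0]]; auto.
    { intros w. apply continuous_const. }
    { apply one_le_one_plus_sq. }
    destruct (moment_stable (fun w => w) (fun w => Rabs (f w) ^ 2)
      (fun w => Rabs (f0 w) ^ 2) B d) as [n1 [I1 J1]]; auto.
    { intros w. apply continuous_id. }
    { apply abs_le_one_plus_sq. }
    destruct (moment_stable (fun w => w ^ 2) (fun w => Rabs (f w) ^ 2)
      (fun w => Rabs (f0 w) ^ 2) B d) as [n2 [I2 J2]]; auto.
    { intros w. apply (ex_derive_continuous (fun w => w ^ 2)). auto_derive. trivial. }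
    { apply pow2_le_one_plus_sq. }
    exists n0, n1, n2. repeat split; auto.
    eapply is_RIntR_ext; [|exact I0]. intros w; simpl; ring. }
  set (m0 := RIntR (fun w => 1 * Rabs (f0 w) ^ 2)) in *.
  set (m1 := RIntR (fun w => w * Rabs (f0 w) ^ 2)) in *.
  set (m2 := RIntR (fun w => w ^ 2 * Rabs (f0 w) ^ 2)) in *.
  assert (R0 : exists n0, L2sq f0 = n0 /\ n0 = m0 /\ freq_radius2 f0 = m2 / m0 - (m1 / m0) ^ 2).
  (* The case [f := f0], [d := 0] yields the convergence of the moments of [f0] itself. *)
  { destruct (Mom f0 0) as [n0 [n1 [n2 [I0 [I1 [I2 [J0 [J1 J2]]]]]]]]; auto.
    { intros w. unfold Rdiv. rewrite Rmult_0_l, Rminus_diag, Rabs_R0. apply Rle_refl. }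
    rewrite Rmult_0_l in J0, J1, J2.
    assert (Z : forall a b, Rabs (a - b) <= 0 -> a = b).
    { intros a b H. apply Rabs_le_between in H. lra. }
    apply Z in J0. apply Z in J1. apply Z in J2.
    assert (E : L2sq f0 = n0) by (apply RIntR_unique; exact I0).
    exists n0. repeat split; auto.
    rewrite (freq_radius2_moments f0 n0 n1 n2); auto; [|lra].
    now rewrite J0, J1, J2. }
  destruct R0 as [n0 [E0 [E1 Ef0]]].
  assert (Hm0 : 0 < m0) by lra.
  pose proof PI_RGT_0 as Hpi.
  set (L1 := 2 * (m0 + Rabs m1) / m0 ^ 2).
  set (L2 := 2 * (m0 + Rabs m2) / m0 ^ 2).
  assert (Hm2 : 0 < m0 ^ 2) by (apply pow_lt; exact Hm0).
  assert (HL1 : 0 <= L1).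
  { apply Rle_div_r; [exact Hm2|]. rewrite Rmult_0_l. pose proof (Rabs_pos m1). lra. }
  assert (HL2 : 0 <= L2).
  { apply Rle_div_r; [exact Hm2|]. rewrite Rmult_0_l. pose proof (Rabs_pos m2). lra. }
  (* [Y] bounds $|x+y|$ in $x^2-y^2=(x-y)(x+y)$ for the two quotients $m_1/m_0$. *)
  set (Y := 2 * Rabs (m1 / m0) + m0 / 2 * L1).
  assert (HY : 0 <= Y).
  { unfold Y. pose proof (Rabs_pos (m1 / m0)). nra. }
  exists (PI * (L2 + L1 * Y)), (m0 / (2 * PI)).
  split; [|split].
  - apply Rmult_le_pos; [lra|]. nra.
  - apply Rdiv_lt_0_compat; lra.
  - intros f d Hd Hc Hfd.
    destruct (Mom f d Hc Hfd) as [k0 [k1 [k2 [I0 [I1 [I2 [J0 [J1 J2]]]]]]]].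
    assert (Hdp : d * PI <= m0 / 2).
    { apply (Rmult_le_compat_r PI) in Hd; [|lra].
      replace (m0 / (2 * PI) * PI) with (m0 / 2) in Hd by (field; lra). exact Hd. }
    assert (Hk0 : 0 < k0) by (apply Rabs_le_between in J0; lra).
    rewrite Ef0, (freq_radius2_moments f k0 k1 k2) by (auto; lra).
    pose proof (quotient_stable k2 k0 m2 m0 _ Hm0 Hdp J2 J0) as Q2.
    pose proof (quotient_stable k1 k0 m1 m0 _ Hm0 Hdp J1 J0) as Q1.
    fold L1 in Q1. fold L2 in Q2.
    assert (Q1' : d * PI * L1 <= m0 / 2 * L1) by (apply Rmult_le_compat_r; auto).
    pose proof (sqr_stable _ _ _ _ Q1 Q1') as Q3. fold Y in Q3.
    replace (k2 / k0 - (k1 / k0) ^ 2 - (m2 / m0 - (m1 / m0) ^ 2))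
      with ((k2 / k0 - m2 / m0) - ((k1 / k0) ^ 2 - (m1 / m0) ^ 2)) by ring.
    eapply Rle_trans; [apply Rabs_triang|]. rewrite Rabs_Ropp. lra.
Qed.

(** * Infinite products *)

Lemma pow2_pos n : 0 < 2 ^ n.
Proof. apply pow_lt; lra. Qed.

Lemma inv_pow2_S n : / 2 ^ S n = / 2 ^ n / 2.
Proof. simpl. pose proof (pow2_pos n). field. lra. Qed.

Lemma div_pow2_le_1 D n : 0 <= D -> 0 <= D / 2 ^ n <= D.
Proof.
  intros HD. pose proof (pow2_pos n). pose proof (pow_R1_Rle 2 n ltac:(lra)).
  split.
  - apply Rmult_le_pos; [exact HD|]. left. now apply Rinv_0_lt_compat.
  - apply Rle_div_l; [exact H|]. nra.
Qed.

Lemma inv_pow2_small eps C : 0 < eps -> exists N, forall n, (N <= n)%nat -> C / 2 ^ n < eps.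
Proof.
  intros He.
  assert (is_lim_seq (fun n => C * (/ 2) ^ n) 0) as H.
  { replace (Finite 0) with (Rbar_mult C 0) by (simpl; f_equal; ring).
    apply is_lim_seq_scal_l. apply is_lim_seq_geom. rewrite Rabs_pos_eq; lra. }
  apply is_lim_seq_spec in H. destruct (H (mkposreal eps He)) as [N HN].
  exists N. intros n Hn. specialize (HN n Hn). simpl in HN.
  rewrite Rminus_0_r in HN. rewrite pow_inv in HN.
  eapply Rle_lt_trans; [apply Rle_abs|exact HN].
Qed.

(** * Partial products whose factors approach 1 geometrically *)

Section PProd.
Variables (f : nat -> R) (D : R).
Hypothesis D_pos : 0 <= D.
Hypothesis f_near_1 : forall j, Rabs (f j - 1) <= D / 2 ^ j.

(** $1+x\le e^x$ for each factor; the exponent is $\sum_{j=1}^N D2^{-j}$. *)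
Lemma pprod_le_exp N : Rabs (pprod f N) <= exp (D * (1 - / 2 ^ N)).
Proof.
  induction N as [|N IH].
  - simpl. rewrite Rabs_R1, Rinv_1, Rminus_diag, Rmult_0_r, exp_0. lra.
  - cbn [pprod]. rewrite Rabs_mult.
    replace (D * (1 - / 2 ^ S N)) with (D * (1 - / 2 ^ N) + D / 2 ^ S N)
      by (unfold Rdiv; rewrite inv_pow2_S; field; pose proof (pow2_pos N); lra).
    rewrite exp_plus. apply Rmult_le_compat; auto using Rabs_pos.
    eapply Rle_trans; [|apply exp_ineq1_le].
    specialize (f_near_1 (S N)).
    replace (f (S N)) with (1 + (f (S N) - 1)) by ring.
    eapply Rle_trans; [apply Rabs_triang|]. rewrite Rabs_R1. lra.
Qed.

Lemma pprod_bounded N : Rabs (pprod f N) <= exp D.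
Proof.
  eapply Rle_trans; [apply pprod_le_exp|].
  assert (D * (1 - / 2 ^ N) <= D) as [H|H].
  { pose proof (Rinv_0_lt_compat _ (pow2_pos N)). nra. }
  - left. now apply exp_increasing.
  - rewrite H. apply Rle_refl.
Qed.

(** The explicit difference $2^{-N}-2^{-(N+k)}$ lets the induction on [k] close by telescoping. *)
Lemma pprod_dist N k :
  Rabs (pprod f (N + k) - pprod f N) <= exp D * D * (/ 2 ^ N - / 2 ^ (N + k)).
Proof.
  induction k as [|k IH].
  - rewrite Nat.add_0_r, Rminus_diag, Rabs_R0. lra.
  - rewrite Nat.add_succ_r. cbn [pprod].
    replace (pprod f (N + k) * f (S (N + k)) - pprod f N)
      with (pprod f (N + k) * (f (S (N + k)) - 1) + (pprod f (N + k) - pprod f N)) by ring.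
    eapply Rle_trans; [apply Rabs_triang|]. rewrite Rabs_mult.
    assert (Rabs (pprod f (N + k)) * Rabs (f (S (N + k)) - 1) <= exp D * (D / 2 ^ S (N + k))).
    { apply Rmult_le_compat; auto using Rabs_pos, pprod_bounded. }
    unfold Rdiv in H. rewrite inv_pow2_S in *. lra.
Qed.

Lemma pprod_dist_le N M : (N <= M)%nat ->
  Rabs (pprod f M - pprod f N) <= exp D * D / 2 ^ N.
Proof.
  intros H. replace M with (N + (M - N))%nat by lia.
  eapply Rle_trans; [apply pprod_dist|]. unfold Rdiv.
  apply Rmult_le_compat_l.
  - apply Rmult_le_pos; auto. left. apply exp_pos.
  - pose proof (Rinv_0_lt_compat _ (pow2_pos (N + (M - N)))). lra.
Qed.

Lemma pprod_cv : exists L : R, is_lim_seq (pprod f) L /\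
  forall N, Rabs (L - pprod f N) <= exp D * D / 2 ^ N.
Proof.
  assert (ex_finite_lim_seq (pprod f)) as [L HL].
  { apply ex_lim_seq_cauchy_corr. intros eps.
    destruct (inv_pow2_small (eps / 2) (exp D * D)) as [N HN].
    { pose proof (cond_pos eps). lra. }
    exists N. intros n p Hn Hp.
    pose proof (pprod_dist_le N n Hn). pose proof (pprod_dist_le N p Hp).
    specialize (HN N (le_n N)).
    replace (pprod f n - pprod f p)
      with ((pprod f n - pprod f N) - (pprod f p - pprod f N)) by ring.
    eapply Rle_lt_trans; [apply Rabs_triang|]. rewrite Rabs_Ropp. lra. }
  exists L. split; [exact HL|]. intros N.
  apply (is_lim_seq_le_loc (fun n => Rabs (pprod f n - pprod f N))
    (fun _ => exp D * D / 2 ^ N) (Rabs (L - pprod f N)) (exp D * D / 2 ^ N)).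
  - exists N. intros n Hn. now apply pprod_dist_le.
  - apply (is_lim_seq_abs _ (L - pprod f N)). apply is_lim_seq_minus'; [exact HL|].
    apply is_lim_seq_const.
  - apply is_lim_seq_const.
Qed.
End PProd.

Lemma pprod_S_l f N : pprod f (S N) = f 1%nat * pprod (fun j => f (S j)) N.
Proof.
  induction N as [|N IH]; [simpl; ring|].
  change (pprod f (S (S N))) with (pprod f (S N) * f (S (S N))).
  rewrite IH. simpl. ring.
Qed.

Lemma pprod_ext f g N : (forall j, f j = g j) -> pprod f N = pprod g N.
Proof. intros H. induction N; simpl; congruence. Qed.

Lemma continuous_pprod (f : nat -> R -> R) N x :
  (forall j, continuous (f j) x) -> continuous (fun w => pprod (fun j => f j w) N) x.
Proof.
  intros H. induction N as [|N IH]; simpl.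
  - apply continuous_const.
  - apply (continuous_mult (fun w => pprod (fun j => f j w) N)); auto.
Qed.

(** The approximation is asked only within radius [r] of [x], since the products and series below
    converge locally uniformly. *)
Lemma continuous_of_uniform_approx (f : R -> R) x r : 0 < r ->
  (forall eps, 0 < eps -> exists g : R -> R, continuous g x /\
     forall w, Rabs (w - x) < r -> Rabs (f w - g w) <= eps) ->
  continuous f x.
Proof.
  intros Hr H. apply filterlim_locally. intros eps.
  destruct (H (eps / 3)) as [g [Hg Hfg]].
  { pose proof (cond_pos eps). lra. }
  assert (He3 : 0 < eps / 3) by (pose proof (cond_pos eps); lra).
  pose proof (proj1 (filterlim_locally _ _) Hg (mkposreal _ He3)) as Hl.
  pose proof (locally_ball x (mkposreal r Hr)) as Hb.
  generalize (filter_and _ _ Hl Hb). apply filter_imp.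
  intros w [H1 H2].
  change (Rabs (g w - g x) < eps / 3) in H1. change (Rabs (w - x) < r) in H2.
  change (Rabs (f w - f x) < eps).
  pose proof (Hfg w H2) as F1.
  assert (F2 : Rabs (f x - g x) <= eps / 3).
  { apply Hfg. rewrite Rminus_diag, Rabs_R0. exact Hr. }
  replace (f w - f x) with ((f w - g w) + ((g w - g x) - (f x - g x))) by ring.
  eapply Rle_lt_trans; [apply Rabs_triang|].
  pose proof (Rabs_triang (g w - g x) (- (f x - g x))) as F3. rewrite Rabs_Ropp in F3.
  unfold Rminus at 2. lra.
Qed.

(** [phil_hat] is [iprod] applied to [ml], up to conversion. *)
Definition iprod (m : R -> R) (w : R) : R :=
  real (Lim_seq (fun N => pprod (fun j => m (w / 2 ^ j)) N)).

Section InfiniteProduct.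
Variables (m : R -> R) (C : R).
Hypothesis C_pos : 0 <= C.
Hypothesis m_near_1 : forall v, Rabs (m v - 1) <= C * Rabs v.

Lemma factor_near_1 w R0 j : Rabs w <= R0 -> Rabs (m (w / 2 ^ j) - 1) <= C * R0 / 2 ^ j.
Proof.
  intros H. eapply Rle_trans; [apply m_near_1|].
  unfold Rdiv at 1. rewrite Rabs_mult, (Rabs_pos_eq (/ _)).
  - unfold Rdiv. rewrite <- Rmult_assoc. apply Rmult_le_compat_r.
    + left. apply Rinv_0_lt_compat, pow2_pos.
    + now apply Rmult_le_compat_l.
  - left. apply Rinv_0_lt_compat, pow2_pos.
Qed.

Lemma iprod_lim_bound w R0 : Rabs w <= R0 ->
  is_lim_seq (fun N => pprod (fun j => m (w / 2 ^ j)) N) (iprod m w) /\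
  (forall N, Rabs (iprod m w - pprod (fun j => m (w / 2 ^ j)) N)
     <= exp (C * R0) * (C * R0) / 2 ^ N).
Proof.
  intros H. pose proof (Rabs_pos w) as Hw.
  assert (0 <= C * R0) by (apply Rmult_le_pos; lra).
  destruct (pprod_cv (fun j => m (w / 2 ^ j)) (C * R0)) as [L [H1 H2]]; auto.
  { intros j. now apply factor_near_1. }
  assert (E : iprod m w = L).
  { change (real (Lim_seq (pprod (fun j => m (w / 2 ^ j)))) = L).
    now rewrite (is_lim_seq_unique _ _ H1). }
  rewrite E. auto.
Qed.

Lemma iprod_lim w :
  is_lim_seq (fun N => pprod (fun j => m (w / 2 ^ j)) N) (iprod m w).
Proof. apply (proj1 (iprod_lim_bound w (Rabs w) (Rle_refl _))). Qed.

Lemma iprod_bounded w R0 : Rabs w <= R0 -> Rabs (iprod m w) <= exp (C * R0).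
Proof.
  intros H. pose proof (Rabs_pos w) as Hw.
  assert (0 <= C * R0) by (apply Rmult_le_pos; lra).
  apply (is_lim_seq_le (fun N => Rabs (pprod (fun j => m (w / 2 ^ j)) N))
    (fun _ => exp (C * R0)) (Rabs (iprod m w)) (exp (C * R0))).
  - intros N. apply pprod_bounded; auto. intros j. now apply factor_near_1.
  - apply (is_lim_seq_abs _ (iprod m w)), iprod_lim.
  - apply is_lim_seq_const.
Qed.

(** The refinement equation: pulling out the factor $j=1$ at $2w$ leaves the product at $w$. *)
Lemma iprod_double w : iprod m (2 * w) = m w * iprod m w.
Proof.
  assert (H1 : is_lim_seq (fun N => pprod (fun j => m (2 * w / 2 ^ j)) (S N)) (iprod m (2 * w))).
  { apply -> (is_lim_seq_incr_1 (pprod (fun j => m (2 * w / 2 ^ j)))). apply iprod_lim. }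
  assert (H2 : is_lim_seq (fun N => m w * pprod (fun j => m (w / 2 ^ j)) N) (m w * iprod m w)).
  { apply (is_lim_seq_scal_l _ (m w) (iprod m w)), iprod_lim. }
  apply (is_lim_seq_ext _ (fun N => m w * pprod (fun j => m (w / 2 ^ j)) N)) in H1.
  - apply is_lim_seq_unique in H1. apply is_lim_seq_unique in H2. congruence.
  - intros N. rewrite pprod_S_l. f_equal.
    + f_equal. simpl. field.
    + apply pprod_ext. intros j. f_equal. simpl. field. pose proof (pow2_pos j). lra.
Qed.

Lemma continuous_iprod : (forall x, continuous m x) -> forall x, continuous (iprod m) x.
Proof.
  intros Hm x. apply (continuous_of_uniform_approx _ x 1); [lra|].
  intros eps He. set (R0 := Rabs x + 1).
  destruct (inv_pow2_small eps (exp (C * R0) * (C * R0)) He) as [N HN].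
  exists (fun w => pprod (fun j => m (w / 2 ^ j)) N). split.
  - apply (continuous_pprod (fun j w => m (w / 2 ^ j))). intros j.
    apply (continuous_comp (fun w => w / 2 ^ j) m); [|apply Hm].
    apply (ex_derive_continuous (fun w => w / 2 ^ j)). auto_derive.
    pose proof (pow2_pos j). trivial.
  - intros w Hw.
    assert (Rabs w <= R0) as HR.
    { unfold R0. replace w with ((w - x) + x) by ring.
      eapply Rle_trans; [apply Rabs_triang|]. lra. }
    eapply Rle_trans; [apply (proj2 (iprod_lim_bound w R0 HR) N)|].
    left. now apply HN.
Qed.

(** Exchanging the $j$-th factor costs $\mu R_02^{-j}$ times the bound on the partial products of
    [m]; thanks to $|b|\le1$ the earlier errors are not amplified. *)
Lemma iprod_compare (b : R -> R) mu w R0 :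
  (forall v, Rabs (b v) <= 1) -> (forall v, Rabs (m v - b v) <= mu * Rabs v) ->
  0 <= mu -> Rabs w <= R0 -> forall L,
  is_lim_seq (fun N => pprod (fun j => b (w / 2 ^ j)) N) (Finite L) ->
  Rabs (iprod m w - L) <= exp (C * R0) * R0 * mu.
Proof.
  intros Hb Hd Hmu HR L HL. pose proof (Rabs_pos w) as Hw.
  set (E := exp (C * R0)).
  assert (HE : 0 < E) by apply exp_pos.
  set (P := fun N => pprod (fun j => m (w / 2 ^ j)) N).
  set (Q := fun N => pprod (fun j => b (w / 2 ^ j)) N).
  assert (HP : forall N, Rabs (P N) <= E).
  { intros N. apply pprod_bounded.
    - apply Rmult_le_pos; lra.
    - intros j. now apply factor_near_1. }
  assert (H : forall N, Rabs (P N - Q N) <= E * R0 * mu * (1 - / 2 ^ N)).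
  { induction N as [|N IH].
    - unfold P, Q; simpl. rewrite Rminus_diag, Rabs_R0. lra.
    - change (P (S N)) with (P N * m (w / 2 ^ S N)).
      change (Q (S N)) with (Q N * b (w / 2 ^ S N)).
      set (v := w / 2 ^ S N).
      replace (P N * m v - Q N * b v) with (P N * (m v - b v) + (P N - Q N) * b v) by ring.
      eapply Rle_trans; [apply Rabs_triang|]. rewrite !Rabs_mult.
      assert (G1 : Rabs (P N) * Rabs (m v - b v) <= E * (mu * (R0 / 2 ^ S N))).
      { apply Rmult_le_compat; auto using Rabs_pos.
        eapply Rle_trans; [apply Hd|]. apply Rmult_le_compat_l; [exact Hmu|].
        unfold v, Rdiv. pose proof (Rinv_0_lt_compat _ (pow2_pos (S N))).
        rewrite Rabs_mult, (Rabs_pos_eq (/ _)) by lra.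
        apply Rmult_le_compat_r; lra. }
      assert (G2 : Rabs (P N - Q N) * Rabs (b v) <= E * R0 * mu * (1 - / 2 ^ N) * 1).
      { apply Rmult_le_compat; auto using Rabs_pos. }
      unfold Rdiv in G1. rewrite inv_pow2_S in *. lra. }
  apply (is_lim_seq_le (fun N => Rabs (P N - Q N)) (fun _ => E * R0 * mu)
     (Rabs (iprod m w - L)) (E * R0 * mu)).
  - intros N. eapply Rle_trans; [apply H|].
    pose proof (Rinv_0_lt_compat _ (pow2_pos N)).
    assert (0 <= E * R0 * mu) by (repeat apply Rmult_le_pos; lra). nra.
  - apply (is_lim_seq_abs _ (iprod m w - L)). apply is_lim_seq_minus'; [apply iprod_lim|exact HL].
  - apply is_lim_seq_const.
Qed.
End InfiniteProduct.

(** * Decay of the refinable function *)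

Definition hsin2 (x : R) : R := sin (x / 2) ^ 2.

Lemma hsin2_cos x : 1 - hsin2 x = cos (x / 2) ^ 2.
Proof. unfold hsin2. pose proof (sin2_cos2 (x / 2)) as H. unfold Rsqr in H. nra. Qed.

Lemma hsin2_bound x : 0 <= hsin2 x <= 1.
Proof.
  split; [apply pow2_ge_0|]. pose proof (hsin2_cos x). pose proof (pow2_ge_0 (cos (x / 2))). lra.
Qed.

Lemma hsin2_double x : hsin2 (2 * x) = 4 * hsin2 x * (1 - hsin2 x).
Proof.
  rewrite hsin2_cos. unfold hsin2. replace (2 * x / 2) with (2 * (x / 2)) by field.
  rewrite sin_2a. ring.
Qed.

Lemma hsin2_half_cos x : hsin2 x = (1 - cos x) / 2.
Proof.
  replace (cos x) with (cos (2 * (x / 2))) by (f_equal; field).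
  rewrite cos_2a_sin. unfold hsin2. field.
Qed.

Lemma cos_Rabs x : cos (Rabs x) = cos x.
Proof. unfold Rabs. destruct (Rcase_abs x); auto using cos_neg. Qed.

(** Such an $|x|$ is within $\pi/3$ of $\pi$. As [tau <= 3 / 4], this annulus lies in the window. *)
Lemma hsin2_ge_three_quarters x :
  2 * PI / 3 <= Rabs x <= 4 * PI / 3 -> 3 / 4 <= hsin2 x.
Proof.
  intros H. rewrite hsin2_half_cos, <- cos_Rabs.
  set (y := Rabs x) in *. pose proof PI_RGT_0.
  assert (E : cos y = - cos (Rabs (y - PI))).
  { rewrite cos_Rabs. replace y with ((y - PI) + PI) at 1 by ring. apply neg_cos. }
  assert (Rabs (y - PI) <= PI / 3) by (apply Rabs_le; lra).
  assert (cos (PI / 3) <= cos (Rabs (y - PI))).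
  { apply cos_decr_1; try lra; apply Rabs_pos. }
  rewrite cos_PI3 in *. lra.
Qed.

Lemma Rabs_half x : Rabs (x / 2) = Rabs x / 2.
Proof. unfold Rdiv. rewrite Rabs_mult, (Rabs_pos_eq (/ 2)) by lra. reflexivity. Qed.

(** Halving until the annulus is reached lands in the window. The exponent [S k] records that at
    least one doubling leads back, the one that yields the factor [al]. *)
Lemma dyadic_scale w : 4 * PI / 3 <= Rabs w ->
  exists k x, w = 2 ^ S k * x /\ 2 * PI / 3 <= Rabs x <= 4 * PI / 3.
Proof.
  intros Hw. pose proof PI_RGT_0 as Hpi.
  destruct (inv_pow2_small 1 (Rabs w)) as [n Hn]; [lra|].
  specialize (Hn n (le_n n)). pose proof (pow2_pos n) as Hp.
  apply Rlt_div_l in Hn; [|exact Hp].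
  assert (Hb : Rabs w <= 2 ^ n * (8 * PI / 3)).
  { pose proof PI2_1. nra. }
  clear Hn Hp. revert w Hw Hb.
  induction n as [|n IH]; intros w Hw Hb.
  - exists O, (w / 2). split; [simpl; field|].
    rewrite Rabs_half. simpl in Hb. lra.
  - destruct (Rle_dec (Rabs w) (8 * PI / 3)) as [H|H].
    + exists O, (w / 2). split; [simpl; field|].
      rewrite Rabs_half. lra.
    + destruct (IH (w / 2)) as [k [x [E Hx]]].
      * rewrite Rabs_half. lra.
      * rewrite Rabs_half. simpl in Hb. lra.
      * exists (S k), x. split; [|exact Hx].
        replace w with (2 * (w / 2)) by field. rewrite E. simpl. ring.
Qed.

(** The boost by $(9/4)^3$ in the window is needed near the fixed point $t=3/4$ of the logistic map,
    where a step into the window may bring almost no growth of $t$ itself. *)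
Definition weight (tau t : R) : R := (if Rle_dec tau t then 9 / 4 * t else t) ^ 3.

Lemma weight_pos tau t : 0 <= t -> 0 <= weight tau t.
Proof. intros H. apply pow_le. destruct (Rle_dec tau t); lra. Qed.

Lemma weight_le tau t : 0 <= t <= 1 -> weight tau t <= 12.
Proof.
  intros H. apply Rle_trans with ((9 / 4) ^ 3); [|lra].
  apply pow_incr. destruct (Rle_dec tau t); lra.
Qed.

(* One doubling step outside the window multiplies the un-cubed weight by at
   least 9/4: two consecutive points outside it force [t < 1/4]. *)
Lemma weight_out tau t : 1 / 2 <= tau <= 3 / 4 -> 0 <= t < tau ->
  (9 / 4) ^ 3 * weight tau t <= weight tau (4 * t * (1 - t)).
Proof.
  intros Htau Ht. unfold weight. rewrite <- Rpow_mult_distr. apply pow_incr.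
  destruct (Rle_dec tau t) as [H|H]; [lra|]. split; [lra|].
  destruct (Rle_dec tau (4 * t * (1 - t))) as [H'|H'].
  - nra.
  - assert (t < 1 / 4); [|nra].
    apply Rnot_le_lt. intros H4. apply H'.
    destruct (Rle_dec t (1 / 2)); nra.
Qed.

(** Before cubing: $(1-t)\cdot\frac94t=\frac9{16}\cdot4t(1-t)$, and the weight of the image is at
    least its unboosted value. *)
Lemma weight_in tau t : 0 <= t <= 1 -> tau <= t ->
  (1 - t) ^ 3 * weight tau t <= (9 / 16) ^ 3 * weight tau (4 * t * (1 - t)).
Proof.
  intros Ht Htau. unfold weight. rewrite <- !Rpow_mult_distr. apply pow_incr.
  destruct (Rle_dec tau t) as [H|H]; [|lra].
  split; [nra|]. destruct (Rle_dec tau (4 * t * (1 - t))); nra.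
Qed.

(** * Decay along a doubling orbit *)

Section Tail.
Variables (m phi : R -> R) (tau al E : R).
Hypothesis tau_bound : 1 / 2 <= tau <= 3 / 4.
Hypothesis al_bound : 0 <= al <= 1 / 4.
Hypothesis m_le_2 : forall x, Rabs (m x) <= 2.
Hypothesis m_window : forall x, tau <= hsin2 x -> Rabs (m x) <= 2 * al * (1 - hsin2 x) ^ 3.
Hypothesis phi_double : forall x, phi (2 * x) = m x * phi x.
Hypothesis phi_le : forall x, Rabs x <= 2 * PI -> Rabs (phi x) <= E.

Let W (x : R) : R := weight tau (hsin2 x).

(** The numerical factor $2\,(9/16)^3$ is below 1, so [al] survives with constant 1. *)
Lemma weight_step_window x : tau <= hsin2 x -> Rabs (m x) * W x <= al * W (2 * x).
Proof.
  intros H. pose proof (hsin2_bound x) as Hb. unfold W. rewrite hsin2_double.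
  pose proof (weight_in tau (hsin2 x) Hb H) as K.
  pose proof (m_window x H) as M.
  assert (P1 : 0 <= weight tau (hsin2 x)) by (apply weight_pos; lra).
  assert (P2 : 0 <= weight tau (4 * hsin2 x * (1 - hsin2 x))).
  { apply weight_pos. nra. }
  apply (Rmult_le_compat_r _ _ _ P1) in M.
  eapply Rle_trans; [exact M|].
  set (a := weight tau (hsin2 x)) in *.
  set (b := weight tau (4 * hsin2 x * (1 - hsin2 x))) in *.
  set (c := (1 - hsin2 x) ^ 3) in *.
  replace (2 * al * c * a) with (2 * al * (c * a)) by ring.
  assert (c * a <= b / 2) by lra. nra.
Qed.

(** In the window, [al <= 1 / 4]; outside, $2\cdot4\le(9/4)^3$. *)
Lemma weight_step x : Rabs (m x) * W x <= / 4 * W (2 * x).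
Proof.
  destruct (Rle_dec tau (hsin2 x)) as [H|H].
  - eapply Rle_trans; [now apply weight_step_window|].
    apply Rmult_le_compat_r; [|lra]. apply weight_pos, hsin2_bound.
  - pose proof (hsin2_bound x) as Hb. unfold W. rewrite hsin2_double.
    assert (Ht : 0 <= hsin2 x < tau) by lra.
    pose proof (weight_out tau (hsin2 x) tau_bound Ht) as K.
    assert (P1 : 0 <= weight tau (hsin2 x)) by (apply weight_pos; lra).
    pose proof (Rmult_le_compat_r _ _ _ P1 (m_le_2 x)). lra.
Qed.

(** Only the doubling that starts at [x] is known to lie in the window and is charged [al]; the
    later ones cost $1/4$ wherever they fall. *)
Lemma tail_chain x k : tau <= hsin2 x ->
  Rabs (phi (2 ^ S k * x)) * W x <= al * (/ 4) ^ k * W (2 ^ S k * x) * Rabs (phi x).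
Proof.
  intros H. induction k as [|k IH].
  - replace (2 ^ 1 * x) with (2 * x) by ring. rewrite phi_double, Rabs_mult.
    pose proof (weight_step_window x H) as K.
    apply (Rmult_le_compat_r (Rabs (phi x))) in K; [|apply Rabs_pos]. simpl. lra.
  - set (y := 2 ^ S k * x) in *.
    replace (2 ^ S (S k) * x) with (2 * y) by (unfold y; simpl; ring).
    rewrite phi_double, Rabs_mult.
    pose proof (weight_step y) as K.
    assert (Rabs (m y) * (Rabs (phi y) * W x)
            <= Rabs (m y) * (al * (/ 4) ^ k * W y * Rabs (phi x))).
    { apply Rmult_le_compat_l; [apply Rabs_pos|exact IH]. }
    assert (P : 0 <= al * (/ 4) ^ k * Rabs (phi x)).
    { repeat apply Rmult_le_pos; [lra|apply pow_le; lra|apply Rabs_pos]. }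
    apply (Rmult_le_compat_l _ _ _ P) in K.
    simpl (_ ^ S k). nra.
Qed.

Lemma tail_bound w : 4 * PI / 3 <= Rabs w ->
  Rabs (phi w) <= 2000 * E * al / (1 + w ^ 2).
Proof.
  intros Hw. destruct (dyadic_scale w Hw) as [k [x [Ew Hx]]].
  pose proof (hsin2_ge_three_quarters x Hx) as Hq.
  pose proof (hsin2_bound x) as Hb.
  pose proof PI_RGT_0 as Hpi. pose proof PI_4 as Hpi4. pose proof PI2_1 as Hpi2.
  pose proof (tail_chain x k ltac:(lra)) as K. rewrite <- Ew in K.
  assert (W1 : 1 <= W x).
  { unfold W, weight. destruct (Rle_dec tau (hsin2 x)); [|lra].
    replace 1 with (1 ^ 3) by ring. apply pow_incr. lra. }
  assert (W2 : 0 <= W w <= 12).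
  { split; [apply weight_pos, hsin2_bound|apply weight_le, hsin2_bound]. }
  assert (PE : Rabs (phi x) <= E) by (apply phi_le; lra).
  pose proof (Rabs_pos (phi x)) as Pp.
  assert (P4 : 0 < (/ 4) ^ k) by (apply pow_lt; lra).
  assert (B : Rabs (phi w) <= al * (/ 4) ^ k * 12 * E).
  { apply Rle_trans with (Rabs (phi w) * W x).
    - pose proof (Rabs_pos (phi w)). nra.
    - eapply Rle_trans; [exact K|].
      assert (0 <= al * (/ 4) ^ k) by (apply Rmult_le_pos; lra).
      apply Rmult_le_compat; try lra.
      + apply Rmult_le_pos; lra.
      + apply Rmult_le_compat_l; lra. }
  apply Rle_div_r; [apply one_plus_sq_pos|].
  (* Here $w^2=4\cdot4^kx^2$ and $x^2\le30$, so the product is at most $1+4\cdot30$; then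
     $12\cdot160\le2000$ gives the final constant. *)
  assert (Hq4 : (/ 4) ^ k * (1 + w ^ 2) <= 160).
  { assert (S1 : w ^ 2 = 4 * 4 ^ k * x ^ 2).
    { rewrite Ew. replace 4 with (2 ^ 2) at 2 by ring. rewrite <- pow_mult.
      rewrite Rpow_mult_distr, <- pow_mult.
      replace (S k * 2)%nat with (2 + 2 * k)%nat by lia. rewrite pow_add. ring. }
    assert (S2 : (/ 4) ^ k * 4 ^ k = 1).
    { rewrite <- Rpow_mult_distr. replace (/ 4 * 4) with 1 by field. apply pow1. }
    assert (S3 : x ^ 2 <= 30).
    { rewrite <- pow2_abs. assert (Rabs x <= 16 / 3) by lra.
      pose proof (Rabs_pos x). nra. }
    assert (S4 : (/ 4) ^ k <= 1).
    { rewrite <- (pow1 k). apply pow_incr. lra. }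
    rewrite S1.
    replace ((/ 4) ^ k * (1 + 4 * 4 ^ k * x ^ 2))
      with ((/ 4) ^ k + 4 * ((/ 4) ^ k * 4 ^ k) * x ^ 2) by ring.
    rewrite S2. lra. }
  pose proof (one_plus_sq_pos w) as Pw.
  apply Rle_trans with (al * (/ 4) ^ k * 12 * E * (1 + w ^ 2)).
  - apply Rmult_le_compat_r; lra.
  - replace (al * (/ 4) ^ k * 12 * E * (1 + w ^ 2))
      with (al * E * 12 * ((/ 4) ^ k * (1 + w ^ 2))) by ring.
    replace (2000 * E * al) with (al * E * 12 * (2000 / 12)) by field.
    apply Rmult_le_compat_l; [|lra].
    repeat apply Rmult_le_pos; lra.
Qed.
End Tail.

(** * Periodization *)

(** Used with [t] an arctangent along an arithmetic progression: its bounded range gives a bound on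
    the sum that does not depend on the starting point. *)
Lemma ex_series_telescoping (a t : nat -> R) A B :
  (forall k, Rabs (a k) <= A * (t (S k) - t k)) ->
  (forall k, A * (t k - t O) <= B) ->
  ex_series (fun k => Rabs (a k)) /\ Rabs (Series a) <= B.
Proof.
  intros Ha HB.
  assert (S1 : forall n, sum_n (fun k => Rabs (a k)) n <= A * (t (S n) - t O)).
  { induction n as [|n IH].
    - rewrite sum_O. apply Ha.
    - rewrite sum_Sn. unfold plus; simpl. pose proof (Ha (S n)). lra. }
  assert (S2 : forall n, sum_n (fun k => Rabs (a k)) n <= B).
  { intros n. eapply Rle_trans; [apply S1|apply HB]. }
  assert (ex_finite_lim_seq (sum_n (fun k => Rabs (a k)))) as [L HL].
  { apply ex_finite_lim_seq_incr with B; [|exact S2].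
    intros n. rewrite sum_Sn. unfold plus; simpl. pose proof (Rabs_pos (a (S n))). lra. }
  assert (HS : is_series (fun k => Rabs (a k)) L) by exact HL.
  split; [now exists L|].
  eapply Rle_trans; [apply Series_Rabs; now exists L|].
  rewrite (is_series_unique _ _ HS).
  apply (is_lim_seq_le _ (fun _ => B) L B S2 HL (is_lim_seq_const B)).
Qed.

(** Integral comparison over one period. By the mean value theorem the increment is $2\pi/(1+c^2)$
    with $|c-v|\le2\pi\le8$, hence $1+c^2\le129(1+v^2)$; and $129\le33\cdot4\le33\cdot2\pi$. *)
Lemma inv_one_plus_sq_le_atan v :
  / (1 + v ^ 2) <= 33 * (atan (v + 2 * PI) - atan v) /\
  / (1 + v ^ 2) <= 33 * (atan v - atan (v - 2 * PI)).
Proof.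
  pose proof PI_RGT_0 as Hpi. pose proof PI_4 as Hpi4. pose proof PI2_1 as Hpi2.
  assert (G : forall a, Rabs (a - v) <= 2 * PI -> Rabs (a + 2 * PI - v) <= 2 * PI ->
    / (1 + v ^ 2) <= 33 * (atan (a + 2 * PI) - atan a)).
  { intros a Ha1 Ha2.
    destruct (MVT_gen atan a (a + 2 * PI) (fun x => / (1 + x ^ 2))) as [c [Hc E]].
    - intros x _. apply is_derive_Reals, derivable_pt_lim_atan.
    - intros x _. apply derivable_continuous_pt.
      exists (/ (1 + x ^ 2)). apply derivable_pt_lim_atan.
    - rewrite E. rewrite Rmin_left, Rmax_right in Hc by lra.
      apply Rabs_le_between in Ha1. apply Rabs_le_between in Ha2.
      assert (Hs : (c - v) ^ 2 <= 64) by nra.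
      assert (Hc2 : 1 + c ^ 2 <= 129 * (1 + v ^ 2)).
      { pose proof (pow2_ge_0 (c - 2 * v)). nra. }
      pose proof (one_plus_sq_pos c) as Pc. pose proof (one_plus_sq_pos v) as Pv.
      assert (Hi : / (129 * (1 + v ^ 2)) <= / (1 + c ^ 2)) by (apply Rinv_le_contravar; lra).
      rewrite Rinv_mult in Hi.
      pose proof (Rinv_0_lt_compat _ Pc). nra. }
  split.
  - apply G.
    + rewrite Rminus_diag, Rabs_R0. lra.
    + replace (v + 2 * PI - v) with (2 * PI) by ring. rewrite Rabs_pos_eq; lra.
  - replace (atan v) with (atan (v - 2 * PI + 2 * PI)) by (f_equal; ring). apply G.
    + replace (v - 2 * PI - v) with (- (2 * PI)) by ring. rewrite Rabs_Ropp, Rabs_pos_eq; lra.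
    + replace (v - 2 * PI + 2 * PI - v) with 0 by ring. rewrite Rabs_R0. lra.
Qed.

Lemma series_right_decay (a : nat -> R) B w : 0 <= B ->
  (forall k, Rabs (a k) <= B / (1 + (w + 2 * PI * INR k) ^ 2)) ->
  ex_series (fun k => Rabs (a k)) /\ Rabs (Series a) <= 33 * B * PI.
Proof.
  intros HB Ha.
  apply (ex_series_telescoping a (fun k => atan (w + 2 * PI * INR k)) (33 * B)).
  - intros k. eapply Rle_trans; [apply Ha|].
    pose proof (proj1 (inv_one_plus_sq_le_atan (w + 2 * PI * INR k))) as H.
    replace (w + 2 * PI * INR (S k)) with (w + 2 * PI * INR k + 2 * PI)
      by (rewrite S_INR; ring).
    apply (Rmult_le_compat_l B) in H; [|exact HB]. unfold Rdiv. lra.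
  - intros k. apply Rmult_le_compat_l; [lra|].
    pose proof (atan_bound (w + 2 * PI * INR k)).
    pose proof (atan_bound (w + 2 * PI * INR 0)). lra.
Qed.

Lemma series_left_decay (a : nat -> R) B w : 0 <= B ->
  (forall k, Rabs (a k) <= B / (1 + (w - 2 * PI * INR (S k)) ^ 2)) ->
  ex_series (fun k => Rabs (a k)) /\ Rabs (Series a) <= 33 * B * PI.
Proof.
  intros HB Ha.
  apply (ex_series_telescoping a (fun k => - atan (w - 2 * PI * INR k)) (33 * B)).
  - intros k. eapply Rle_trans; [apply Ha|].
    pose proof (proj1 (inv_one_plus_sq_le_atan (w - 2 * PI * INR (S k)))) as H.
    replace (w - 2 * PI * INR (S k) + 2 * PI) with (w - 2 * PI * INR k) in H
      by (rewrite S_INR; ring).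
    apply (Rmult_le_compat_l B) in H; [|exact HB]. unfold Rdiv. lra.
  - intros k. apply Rmult_le_compat_l; [lra|].
    pose proof (atan_bound (w - 2 * PI * INR k)).
    pose proof (atan_bound (w - 2 * PI * INR 0)). lra.
Qed.

Lemma continuous_sum_n (f : nat -> R -> R) n x :
  (forall k, continuous (f k) x) -> continuous (fun w => sum_n (fun k => f k w) n) x.
Proof.
  intros H. induction n as [|n IH].
  - apply continuous_ext with (f O); [|apply H]. intros w. now rewrite sum_O.
  - apply continuous_ext with (fun w => plus (sum_n (fun k => f k w) n) (f (S n) w)).
    + intros w. now rewrite sum_Sn.
    + apply (continuous_plus (fun w => sum_n (fun k => f k w) n)); auto.
Qed.

(** Weierstrass test with a majorant on the unit ball around [x]: a partial sum is the approximant,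
    the tail of [M] the error. *)
Lemma continuous_Series (f : nat -> R -> R) (M : nat -> R) x :
  (forall k, continuous (f k) x) ->
  (forall k w, Rabs (w - x) < 1 -> Rabs (f k w) <= M k) -> ex_series M ->
  continuous (fun w => Series (fun k => f k w)) x.
Proof.
  intros Hc Hb HM. apply (continuous_of_uniform_approx _ x 1); [lra|].
  intros eps He.
  pose proof (Series_correct M HM) as HS.
  change (is_lim_seq (sum_n M) (Series M)) in HS.
  apply is_lim_seq_spec in HS. destruct (HS (mkposreal eps He)) as [N HN].
  specialize (HN N (le_n N)). simpl in HN.
  exists (fun w => sum_n (fun k => f k w) N). split; [now apply continuous_sum_n|].
  intros w Hw.
  assert (Ea : ex_series (fun k => Rabs (f k w))).
  { apply (ex_series_le (K := R_AbsRing) (V := R_CompleteNormedModule) _ M); [|exact HM].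
    intros n. unfold norm; simpl. unfold abs; simpl. rewrite Rabs_Rabsolu. now apply Hb. }
  assert (Ef : ex_series (fun k => f k w)) by now apply ex_series_Rabs.
  rewrite (Series_incr_n (fun k => f k w) (S N)) by (auto; lia). simpl pred.
  rewrite (Series_incr_n M (S N)) in HN by (auto; lia). simpl pred in HN.
  rewrite <- sum_n_Reals in HN |- *.
  match goal with |- Rabs ?z <= _ =>
    replace z with (Series (fun k => f (S N + k)%nat w)) by ring end.
  match type of HN with Rabs ?z < _ =>
    replace z with (- Series (fun k => M (S N + k)%nat)) in HN by ring end.
  rewrite Rabs_Ropp in HN.
  assert (EM' : ex_series (fun k => M (S N + k)%nat)) by now apply ex_series_incr_n.
  assert (Ea' : ex_series (fun k => Rabs (f (S N + k)%nat w))).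
  { now apply (ex_series_incr_n (fun k => Rabs (f k w))). }
  eapply Rle_trans; [apply Series_Rabs; exact Ea'|].
  eapply Rle_trans; [apply Series_le; [|exact EM']|].
  - intros n. split; [apply Rabs_pos|now apply Hb].
  - left. eapply Rle_lt_trans; [apply Rle_abs|exact HN].
Qed.

(** [Phil] is the bracket of the square of [phil_hat], up to conversion. The sum over $\mathbb Z$ is
    split at 0, and [S k] keeps the central term from being counted twice. *)
Definition bracket (g : R -> R) (w : R) : R :=
  Series (fun k => g (w + 2 * PI * INR k)) + Series (fun k => g (w - 2 * PI * INR (S k))).

(** Peetre's inequality: it trades decay at the translate $w+b$ for decay in $b$ alone, locally
    uniformly in $w$, as a majorant of the series requires. *)
Lemma peetre w b : / (1 + (w + b) ^ 2) <= 2 * (1 + w ^ 2) / (1 + b ^ 2).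
Proof.
  pose proof (one_plus_sq_pos (w + b)) as H1. pose proof (one_plus_sq_pos b) as H2.
  apply Rle_div_r; [exact H2|]. rewrite Rmult_comm. apply Rle_div_l; [exact H1|].
  assert (b ^ 2 <= 2 * w ^ 2 + 2 * (w + b) ^ 2) by (pose proof (pow2_ge_0 (2 * w + b)); nra).
  pose proof (pow2_ge_0 w). pose proof (pow2_ge_0 (w + b)). nra.
Qed.

Section Bracket.
Variables (g : R -> R) (B : R).
Hypothesis g_decay : forall v, Rabs (g v) <= B / (1 + v ^ 2).

Lemma decay_const_pos : 0 <= B.
Proof.
  specialize (g_decay 0). pose proof (Rabs_pos (g 0)).
  replace (B / (1 + 0 ^ 2)) with B in g_decay by field. lra.
Qed.

Lemma ex_series_bracket w :
  ex_series (fun k => g (w + 2 * PI * INR k)) /\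
  ex_series (fun k => g (w - 2 * PI * INR (S k))).
Proof.
  pose proof decay_const_pos.
  split; apply ex_series_Rabs.
  - now apply (series_right_decay _ B w).
  - now apply (series_left_decay _ B w).
Qed.

Lemma bracket_bound w : Rabs (bracket g w) <= 66 * B * PI.
Proof.
  pose proof decay_const_pos. unfold bracket.
  eapply Rle_trans; [apply Rabs_triang|].
  destruct (series_right_decay (fun k => g (w + 2 * PI * INR k)) B w) as [_ H1]; auto.
  destruct (series_left_decay (fun k => g (w - 2 * PI * INR (S k))) B w) as [_ H2]; auto.
  lra.
Qed.

(** A translation by one period moves a single term from one half-series to the other. *)
Lemma bracket_shift w : bracket g (w + 2 * PI) = bracket g w.
Proof.
  unfold bracket.
  rewrite (Series_incr_1 (fun k => g (w + 2 * PI * INR k)))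
    by apply ex_series_bracket.
  rewrite (Series_incr_1 (fun k => g (w + 2 * PI - 2 * PI * INR (S k))))
    by apply ex_series_bracket.
  replace (w + 2 * PI * INR 0) with w by (simpl; ring).
  replace (w + 2 * PI - 2 * PI * INR 1) with w by (simpl; ring).
  rewrite (Series_ext (fun k => g (w + 2 * PI + 2 * PI * INR k))
                      (fun k => g (w + 2 * PI * INR (S k)))).
  2:{ intros k. f_equal. rewrite S_INR. ring. }
  rewrite (Series_ext (fun k => g (w + 2 * PI - 2 * PI * INR (S (S k))))
                      (fun k => g (w - 2 * PI * INR (S k)))).
  2:{ intros k. f_equal. rewrite !S_INR. ring. }
  ring.
Qed.

Lemma bracket_shift_nat n w : bracket g (w + 2 * PI * INR n) = bracket g w.
Proof.
  induction n as [|n IH].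
  - f_equal. simpl. ring.
  - rewrite <- IH, <- (bracket_shift (w + 2 * PI * INR n)). apply f_equal. rewrite S_INR. ring.
Qed.

Lemma bracket_shift_Z (n : Z) w : bracket g (w + 2 * PI * IZR n) = bracket g w.
Proof.
  destruct (Z_le_gt_dec 0 n) as [H|H].
  - rewrite <- (Z2Nat.id n H), <- INR_IZR_INZ. apply bracket_shift_nat.
  - rewrite <- (bracket_shift_nat (Z.to_nat (- n)) (w + 2 * PI * IZR n)).
    apply f_equal. rewrite INR_IZR_INZ, Z2Nat.id, opp_IZR by lia. ring.
Qed.

Lemma g_shift_bound x w b : Rabs (w - x) < 1 ->
  Rabs (g (w + b)) <= (B * (2 * (1 + (Rabs x + 1) ^ 2))) / (1 + b ^ 2).
Proof.
  intros Hw. pose proof decay_const_pos as HB.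
  eapply Rle_trans; [apply g_decay|]. unfold Rdiv at 1.
  pose proof (peetre w b) as P.
  assert (Hw2 : w ^ 2 <= (Rabs x + 1) ^ 2).
  { rewrite <- (pow2_abs w). apply pow_incr. split; [apply Rabs_pos|].
    replace w with ((w - x) + x) by ring. eapply Rle_trans; [apply Rabs_triang|]. lra. }
  pose proof (Rinv_0_lt_compat _ (one_plus_sq_pos b)) as Pb.
  unfold Rdiv in *. rewrite Rmult_assoc. apply Rmult_le_compat_l; [exact HB|].
  eapply Rle_trans; [exact P|]. apply Rmult_le_compat_r; lra.
Qed.

Lemma continuous_bracket : (forall x, continuous g x) -> forall x, continuous (bracket g) x.
Proof.
  intros Hg x. pose proof decay_const_pos as HB.
  set (B' := B * (2 * (1 + (Rabs x + 1) ^ 2))).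
  assert (HB' : 0 <= B').
  { apply Rmult_le_pos; [exact HB|]. pose proof (pow2_ge_0 (Rabs x + 1)). lra. }
  assert (Hpos : forall b, 0 <= B' / (1 + b ^ 2)).
  { intros b. apply Rmult_le_pos; [exact HB'|]. left.
    apply Rinv_0_lt_compat, one_plus_sq_pos. }
  assert (Hsh : forall b, continuous (fun w => g (w + b)) x).
  { intros b. apply (continuous_comp (fun w => w + b) g); [|apply Hg].
    apply (ex_derive_continuous (fun w => w + b)). auto_derive. trivial. }
  unfold bracket.
  apply (continuous_plus (fun w => Series (fun k => g (w + 2 * PI * INR k)))
           (fun w => Series (fun k => g (w - 2 * PI * INR (S k))))).
  - apply (continuous_Series (fun k w => g (w + 2 * PI * INR k))
             (fun k => B' / (1 + (2 * PI * INR k) ^ 2))).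
    + intros k. apply Hsh.
    + intros k w Hw. now apply g_shift_bound.
    + apply ex_series_Rabs. apply (series_right_decay _ B' 0 HB').
      intros k. rewrite Rabs_pos_eq by apply Hpos. rewrite Rplus_0_l. apply Rle_refl.
  - apply (continuous_Series (fun k w => g (w - 2 * PI * INR (S k)))
             (fun k => B' / (1 + (- (2 * PI * INR (S k))) ^ 2))).
    + intros k. apply Hsh.
    + intros k w Hw. now apply g_shift_bound.
    + apply ex_series_Rabs. apply (series_left_decay _ B' 0 HB').
      intros k. rewrite Rabs_pos_eq by apply Hpos. unfold Rminus. rewrite Rplus_0_l. apply Rle_refl.
Qed.
End Bracket.

Lemma bracket_minus f g B B' w :
  (forall v, Rabs (f v) <= B / (1 + v ^ 2)) -> (forall v, Rabs (g v) <= B' / (1 + v ^ 2)) ->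
  bracket f w - bracket g w = bracket (fun v => f v - g v) w.
Proof.
  intros Hf Hg. unfold bracket.
  destruct (ex_series_bracket f B Hf w) as [F1 F2].
  destruct (ex_series_bracket g B' Hg w) as [G1 G2].
  rewrite (Series_minus _ _ F1 G1), (Series_minus _ _ F2 G2). ring.
Qed.

(** * The Meyer mask and scaling function *)

Lemma red2pi_eq (n : Z) w : - PI <= w - 2 * PI * IZR n < PI -> red2pi w = w - 2 * PI * IZR n.
Proof.
  intros H. unfold red2pi. replace (Int_part ((w + PI) / (2 * PI))) with n; [reflexivity|].
  pose proof PI_RGT_0. apply Int_part_spec.
  split.
  - apply Rlt_minus_l. apply Rlt_div_l; lra.
  - apply Rle_div_r; lra.
Qed.

Lemma red2pi_decomp w : - PI <= red2pi w < PI /\ exists n : Z, w = red2pi w + 2 * PI * IZR n.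
Proof.
  pose proof PI_RGT_0.
  unfold red2pi. set (x := (w + PI) / (2 * PI)). pose proof (base_Int_part x) as [H1 H2].
  assert (E : w = 2 * PI * x - PI) by (unfold x; field; lra).
  split; [|exists (Int_part x); ring].
  rewrite E. split; nra.
Qed.

Lemma cos_shift_Z (n : Z) x : cos (x + 2 * PI * IZR n) = cos x.
Proof.
  assert (G : forall (k : nat) x, cos (x + 2 * PI * INR k) = cos x).
  { intros k y. rewrite <- (cos_period y k). f_equal. ring. }
  destruct (Z_le_gt_dec 0 n) as [H|H].
  - rewrite <- (Z2Nat.id n H), <- INR_IZR_INZ. apply G.
  - rewrite <- (G (Z.to_nat (- n)) (x + 2 * PI * IZR n)).
    apply f_equal. rewrite INR_IZR_INZ, Z2Nat.id, opp_IZR by lia. ring.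
Qed.

Lemma sin_shift_Z (n : Z) x : sin (x + 2 * PI * IZR n) = sin x.
Proof.
  rewrite !sin_cos. replace (PI / 2 + (x + 2 * PI * IZR n)) with (PI / 2 + x + 2 * PI * IZR n) by ring.
  now rewrite cos_shift_Z.
Qed.

Lemma cos_half_pow x l : cos (x / 2) ^ (2 * l) = (1 - hsin2 x) ^ l.
Proof. rewrite hsin2_cos, <- pow_mult. reflexivity. Qed.

Lemma hsin2_shift_Z (n : Z) x : hsin2 (x + 2 * PI * IZR n) = hsin2 x.
Proof. rewrite !hsin2_half_cos, cos_shift_Z. reflexivity. Qed.

Lemma Series_0 (a : nat -> R) : (forall n, a n = 0) -> Series a = 0.
Proof.
  intros H. apply is_series_unique. apply is_series_ext with (fun _ => 0); [auto|].
  apply (is_lim_seq_ext (fun _ => 0) (sum_n (fun _ => 0)) 0); [|apply is_lim_seq_const].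
  intros n. rewrite sum_n_const. ring.
Qed.

Section Meyer.
Variables (theta : R -> R) (w0 : R).
Hypothesis theta_odd : odd_fun theta.
Hypothesis theta_incr : nondecr theta.
Hypothesis theta_C2 : C2fun theta.
Hypothesis theta_far : forall w, w > PI / 3 -> theta w = PI / 4.
Hypothesis w0_bound : PI / 3 <= w0 < PI / 2.

Notation phiM := (meyer_phi_hat theta w0).
Notation mask := (meyer_mask theta w0).

(** The hypothesis on [theta] is strict; the endpoint $\pi/3$ follows by continuity and
    monotonicity. It is met exactly at $|w|=2\pi-2\omega_0$, and its opposite at $|w|=2\omega_0$. *)
Lemma theta_right w : PI / 3 <= w -> theta w = PI / 4.
Proof.
  intros [H|H]; [now apply theta_far|]. subst w.
  assert (Hc : continuous theta (PI / 3)).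
  { apply (ex_derive_continuous theta). apply theta_C2. }
  apply Rle_antisym.
  - rewrite <- (theta_far (PI / 3 + 1)) by lra. apply theta_incr. lra.
  - apply Rnot_lt_le. intros Hlt.
    assert (He : 0 < PI / 4 - theta (PI / 3)) by lra.
    pose proof (proj1 (filterlim_locally _ _) Hc (mkposreal _ He)) as [d Hd].
    specialize (Hd (PI / 3 + d / 2)).
    assert (Rabs (theta (PI / 3 + d / 2) - theta (PI / 3)) < PI / 4 - theta (PI / 3)) as K.
    { apply Hd. change (Rabs (PI / 3 + d / 2 - PI / 3) < d).
      replace (PI / 3 + d / 2 - PI / 3) with (d / 2) by ring.
      pose proof (cond_pos d). rewrite Rabs_pos_eq; lra. }
    rewrite theta_far in K by (pose proof (cond_pos d); lra).
    rewrite Rabs_pos_eq in K; lra.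
Qed.

Lemma theta_left w : w <= - (PI / 3) -> theta w = - (PI / 4).
Proof.
  intros H. replace w with (- - w) by ring. rewrite theta_odd, theta_right by lra. reflexivity.
Qed.

Lemma theta_bound w : - (PI / 4) <= theta w <= PI / 4.
Proof.
  split.
  - rewrite <- (theta_left (Rmin w (- (PI / 3)))) by apply Rmin_r. apply theta_incr, Rmin_l.
  - rewrite <- (theta_right (Rmax w (PI / 3))) by apply Rmax_r. apply theta_incr, Rmax_l.
Qed.

(** The middle formula of the Meyer function without case distinction: outside
    $[2\omega_0,2\pi-2\omega_0]$ the saturation of [theta] already produces 1 and 0. *)
Definition meyer_profile (y : R) : R :=
  cos (PI / 4 + theta (PI / (3 * (PI - 2 * w0)) * (y - PI))).

Lemma profile_left y : y <= 2 * w0 -> meyer_profile y = 1.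
Proof.
  intros H. pose proof PI_RGT_0. unfold meyer_profile. rewrite theta_left.
  - replace (PI / 4 + - (PI / 4)) with 0 by ring. apply cos_0.
  - replace (PI / (3 * (PI - 2 * w0)) * (y - PI))
      with (- (PI / 3) * ((PI - y) / (PI - 2 * w0))) by (field; lra).
    assert (1 <= (PI - y) / (PI - 2 * w0)) by (apply Rle_div_r; lra). nra.
Qed.

Lemma profile_right y : 2 * PI - 2 * w0 <= y -> meyer_profile y = 0.
Proof.
  intros H. pose proof PI_RGT_0. unfold meyer_profile. rewrite theta_right.
  - replace (PI / 4 + PI / 4) with (PI / 2) by field. apply cos_PI2.
  - replace (PI / (3 * (PI - 2 * w0)) * (y - PI))
      with (PI / 3 * ((y - PI) / (PI - 2 * w0))) by (field; lra).
    assert (1 <= (y - PI) / (PI - 2 * w0)) by (apply Rle_div_r; lra). nra.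
Qed.

Lemma profile_bound y : 0 <= meyer_profile y <= 1.
Proof.
  split; [|apply COS_bound]. unfold meyer_profile.
  pose proof PI_RGT_0.
  match goal with |- context [theta ?z] => pose proof (theta_bound z) end.
  apply cos_ge_0; lra.
Qed.

(** Reflection about $\pi$ flips the argument of the odd [theta], which turns the cosine into the
    sine of the same angle. *)
Lemma profile_partition y : meyer_profile y ^ 2 + meyer_profile (2 * PI - y) ^ 2 = 1.
Proof.
  unfold meyer_profile.
  replace (PI / (3 * (PI - 2 * w0)) * (2 * PI - y - PI))
    with (- (PI / (3 * (PI - 2 * w0)) * (y - PI))) by (field; lra).
  rewrite theta_odd. set (t := theta _).
  replace (PI / 4 + - t) with (PI / 2 - (PI / 4 + t)) by field.
  rewrite cos_shift. pose proof (sin2_cos2 (PI / 4 + t)) as H. unfold Rsqr in H. nra.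
Qed.

Lemma phiM_profile w : phiM w = meyer_profile (Rabs w).
Proof.
  unfold meyer_phi_hat. destruct (Rle_dec (Rabs w) (2 * w0)) as [H|H].
  - now rewrite profile_left.
  - destruct (Rle_dec (Rabs w) (2 * PI - 2 * w0)) as [H'|H']; [reflexivity|].
    rewrite profile_right; lra.
Qed.

(* One of the two factors is always 1; this form is visibly smooth at 0. *)
Lemma phiM_prod w : phiM w = meyer_profile w * meyer_profile (- w).
Proof.
  rewrite phiM_profile. pose proof PI_RGT_0. unfold Rabs. destruct (Rcase_abs w).
  - rewrite (profile_left w) by lra. ring.
  - rewrite (profile_left (- w)) by lra. ring.
Qed.

Lemma phiM_bound w : 0 <= phiM w <= 1.
Proof. rewrite phiM_profile. apply profile_bound. Qed.

Lemma phiM_center w : Rabs w <= 2 * w0 -> phiM w = 1.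
Proof. intros H. rewrite phiM_profile. now apply profile_left. Qed.

Lemma phiM_far w : 2 * PI - 2 * w0 <= Rabs w -> phiM w = 0.
Proof. intros H. rewrite phiM_profile. now apply profile_right. Qed.

Lemma phiM_partition w : 0 <= w <= 2 * PI -> phiM w ^ 2 + phiM (w - 2 * PI) ^ 2 = 1.
Proof.
  intros H. rewrite !phiM_profile, (Rabs_pos_eq w) by lra.
  rewrite Rabs_minus_sym, Rabs_pos_eq by lra. apply profile_partition.
Qed.

Lemma profile_C1 y : ex_derive meyer_profile y /\ continuous (Derive meyer_profile) y.
Proof.
  set (k := PI / (3 * (PI - 2 * w0))).
  assert (D : forall y, is_derive meyer_profile y
    (- sin (PI / 4 + theta (k * (y - PI))) * (Derive theta (k * (y - PI)) * k))).
  { intros z. unfold meyer_profile. fold k. auto_derive.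
    - apply theta_C2.
    - change (Derive (fun x => theta x)) with (Derive theta). unfold Rminus. ring. }
  split; [eexists; apply D|].
  apply continuous_ext with (fun y =>
    - sin (PI / 4 + theta (k * (y - PI))) * (Derive theta (k * (y - PI)) * k)).
  { intros z. symmetry. apply is_derive_unique, D. }
  assert (A : continuous (fun y => k * (y - PI)) y).
  { apply (ex_derive_continuous (fun y => k * (y - PI))). auto_derive. trivial. }
  apply (continuous_mult (fun y => - sin (PI / 4 + theta (k * (y - PI))))
     (fun y => Derive theta (k * (y - PI)) * k)).
  - apply (ex_derive_continuous (fun y => - sin (PI / 4 + theta (k * (y - PI))))).
    auto_derive. apply theta_C2.
  - apply (continuous_mult (fun y => Derive theta (k * (y - PI))) (fun _ => k)).
    + apply (continuous_comp (fun y => k * (y - PI)) (Derive theta)); [exact A|].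
      apply (ex_derive_continuous (Derive theta)). apply theta_C2.
    + apply continuous_const.
Qed.

Lemma is_derive_phiM w : is_derive phiM w
  (Derive meyer_profile w * meyer_profile (- w) - meyer_profile w * Derive meyer_profile (- w)).
Proof.
  apply is_derive_ext with (fun w => meyer_profile w * meyer_profile (- w)).
  { intros z. symmetry. apply phiM_prod. }
  auto_derive.
  - split; [apply profile_C1|]. split; [apply profile_C1|trivial].
  - change (Derive (fun x => meyer_profile x)) with (Derive meyer_profile). ring.
Qed.

Lemma continuous_phiM w : continuous phiM w.
Proof. apply (ex_derive_continuous phiM). eexists. apply is_derive_phiM. Qed.

Lemma continuous_Derive_phiM w : continuous (Derive phiM) w.
Proof.
  eapply continuous_ext.
  { intros z. symmetry. apply is_derive_unique, is_derive_phiM. }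
  assert (O : continuous (fun w : R => - w) w).
  { apply (ex_derive_continuous (fun w => - w)). auto_derive. trivial. }
  assert (C : forall z, continuous meyer_profile z).
  { intros z. apply (ex_derive_continuous meyer_profile), profile_C1. }
  apply (continuous_minus (fun w => Derive meyer_profile w * meyer_profile (- w))
    (fun w => meyer_profile w * Derive meyer_profile (- w))).
  - apply (continuous_mult (Derive meyer_profile) (fun w => meyer_profile (- w))).
    + apply profile_C1.
    + apply (continuous_comp (fun w => - w) meyer_profile); auto.
  - apply (continuous_mult meyer_profile (fun w => Derive meyer_profile (- w))); auto.
    apply (continuous_comp (fun w => - w) (Derive meyer_profile)); auto. apply profile_C1.
Qed.

(** The support lies in $|v|\le4\pi/3\le16/3$, where $1+v^2\le40$. *)
Lemma phiM_sq_decay v : Rabs (phiM v ^ 2) <= 40 / (1 + v ^ 2).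
Proof.
  pose proof PI_4. pose proof PI_RGT_0. pose proof (one_plus_sq_pos v).
  rewrite Rabs_pos_eq by apply pow2_ge_0. apply (Rle_div_r _ _ (1 + v ^ 2)); [lra|].
  destruct (Rle_dec (2 * PI - 2 * w0) (Rabs v)) as [Hv|Hv].
  - rewrite phiM_far by exact Hv. lra.
  - pose proof (phiM_bound v) as Hb.
    assert (v ^ 2 <= 39).
    { rewrite <- pow2_abs. pose proof (Rabs_pos v). assert (Rabs v <= 16 / 3) by lra. nra. }
    assert (phiM v ^ 2 <= 1) by nra. pose proof (pow2_ge_0 (phiM v)). nra.
Qed.

Lemma phiM_decay v : phiM v <= 40 / (1 + v ^ 2).
Proof.
  pose proof (phiM_sq_decay v) as H. pose proof (phiM_bound v) as Hb.
  destruct (Rle_dec (2 * PI - 2 * w0) (Rabs v)) as [Hv|Hv].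
  - rewrite phiM_far in * by exact Hv. rewrite pow_i, Rabs_R0 in H by lia. exact H.
  - pose proof PI_4. pose proof PI_RGT_0. pose proof (one_plus_sq_pos v).
    apply (Rle_div_r _ _ (1 + v ^ 2)); [lra|].
    assert (v ^ 2 <= 39).
    { rewrite <- pow2_abs. pose proof (Rabs_pos v). assert (Rabs v <= 16 / 3) by lra. nra. }
    nra.
Qed.

(** Orthonormality of the integer translates of the Meyer function. On $[0,2\pi)$ only the terms
    $k=0$ and $k=-1$ survive, and their squares add up to 1. *)
Lemma bracket_phiM w : bracket (fun v => phiM v ^ 2) w = 1.
Proof.
  pose proof PI_RGT_0 as Hpi.
  destruct (red2pi_decomp (w - PI)) as [Hr [n En]].
  set (y := red2pi (w - PI) + PI) in *.
  replace w with (y + 2 * PI * IZR n) by (unfold y; lra).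
  assert (Hy : 0 <= y < 2 * PI) by (unfold y; lra).
  rewrite (bracket_shift_Z _ 40 phiM_sq_decay). unfold bracket.
  destruct (ex_series_bracket _ 40 phiM_sq_decay y) as [S1 S2].
  rewrite (Series_incr_1 _ S1), (Series_incr_1 _ S2).
  rewrite (Series_0 (fun k => phiM (y + 2 * PI * INR (S k)) ^ 2)).
  2:{ intros k. rewrite S_INR. pose proof (pos_INR k). rewrite phiM_far; [ring|].
      assert (0 <= PI * INR k) by (apply Rmult_le_pos; lra).
      rewrite Rabs_pos_eq; lra. }
  rewrite (Series_0 (fun k => phiM (y - 2 * PI * INR (S (S k))) ^ 2)).
  2:{ intros k. rewrite !S_INR. pose proof (pos_INR k). rewrite phiM_far; [ring|].
      assert (0 <= PI * INR k) by (apply Rmult_le_pos; lra).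
      rewrite Rabs_minus_sym, Rabs_pos_eq; lra. }
  simpl INR. rewrite Rmult_0_r, Rmult_1_r, !Rplus_0_r.
  pose proof (phiM_partition y ltac:(lra)). lra.
Qed.

(** Beyond $\pm\pi$, up to distance $\omega_0$, the periodic copy and [phiM (2 * w)] both vanish;
    thus one smooth formula holds across the ends of the period. *)
Lemma mask_near w : Rabs w < PI + w0 -> mask w = phiM (2 * w).
Proof.
  intros H. pose proof PI_RGT_0. apply Rabs_def2 in H. unfold meyer_mask.
  destruct (Rlt_dec w (- PI)) as [H1|H1]; [|destruct (Rlt_dec w PI) as [H2|H2]].
  - rewrite (red2pi_eq (-1)) by lra.
    rewrite !phiM_far; auto; [rewrite Rabs_left|rewrite Rabs_pos_eq]; lra.
  - rewrite (red2pi_eq 0) by lra. f_equal. ring.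
  - rewrite (red2pi_eq 1) by lra.
    rewrite !phiM_far; auto; [rewrite Rabs_pos_eq|rewrite Rabs_left]; lra.
Qed.

Lemma mask_shift_Z (n : Z) w : mask (w + 2 * PI * IZR n) = mask w.
Proof.
  unfold meyer_mask. do 2 f_equal.
  destruct (red2pi_decomp w) as [H [k E]].
  rewrite (red2pi_eq (k + n)); rewrite plus_IZR; lra.
Qed.

Lemma mask_bound w : 0 <= mask w <= 1.
Proof. apply phiM_bound. Qed.

Lemma mask_center w : Rabs w <= w0 -> mask w = 1.
Proof.
  intros H. pose proof PI_RGT_0. rewrite mask_near by lra. apply phiM_center.
  rewrite Rabs_mult, Rabs_pos_eq; lra.
Qed.

(** The mask is 1 up to $\omega_0\ge\pi/3>1$; farther out the right side exceeds 1. *)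
Lemma mask_near_1 v : Rabs (mask v - 1) <= Rabs v.
Proof.
  pose proof PI2_3_2. destruct (Rle_dec (Rabs v) w0) as [H1|H1].
  - rewrite mask_center, Rminus_diag, Rabs_R0 by exact H1. apply Rabs_pos.
  - pose proof (mask_bound v). apply Rle_trans with 1; [apply Rabs_le|]; lra.
Qed.

(** The value of [hsin2] at $\pi-\omega_0$, the edge of the support of the mask within
    $[-\pi,\pi]$. *)
Definition meyer_tau : R := (1 + cos w0) / 2.

Lemma meyer_tau_bound : 1 / 2 <= meyer_tau <= 3 / 4.
Proof.
  pose proof PI_RGT_0. unfold meyer_tau.
  assert (0 <= cos w0) by (apply cos_ge_0; lra).
  assert (cos w0 <= cos (PI / 3)) by (apply cos_decr_1; lra).
  rewrite cos_PI3 in *. lra.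
Qed.

Lemma mask_window w : meyer_tau <= hsin2 w -> mask w = 0.
Proof.
  intros H. pose proof PI_RGT_0. destruct (red2pi_decomp w) as [Hr [n E]].
  unfold meyer_mask. apply phiM_far. rewrite E, hsin2_shift_Z in H.
  set (r := red2pi w) in *. rewrite Rabs_mult, (Rabs_pos_eq 2) by lra.
  apply Rnot_lt_le. intros Hlt.
  rewrite hsin2_half_cos, <- cos_Rabs in H. unfold meyer_tau in H.
  assert (Rabs r <= PI) by (apply Rabs_le; lra).
  assert (cos (PI - w0) < cos (Rabs r)).
  { apply cos_decreasing_1; try lra; apply Rabs_pos. }
  rewrite Rtrigo_facts.cos_pi_minus in *. lra.
Qed.

(** Induction on the refinement equation of [phiM], valid for $|v|\le2\pi$: either $|v|\le4\omega_0$
    and the value at $v/2$ is 1, or $|v|>4\omega_0\ge2\pi-2\omega_0$ and both sides vanish. The last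
    inequality uses $\omega_0\ge\pi/3$. *)
Lemma pprod_mask w N : Rabs w <= 2 * PI ->
  pprod (fun j => mask (w / 2 ^ j)) N * phiM (w / 2 ^ N) = phiM w.
Proof.
  intros Hw. pose proof PI_RGT_0. induction N as [|N IH].
  - simpl. replace (w / 1) with w by field. ring.
  - cbn [pprod]. rewrite <- IH. rewrite Rmult_assoc. f_equal.
    set (v := w / 2 ^ N).
    replace (w / 2 ^ S N) with (v / 2).
    2:{ unfold v. simpl. field. pose proof (pow2_pos N). lra. }
    assert (Hv : Rabs v <= 2 * PI).
    { unfold v, Rdiv. pose proof (Rinv_0_lt_compat _ (pow2_pos N)).
      rewrite Rabs_mult, (Rabs_pos_eq (/ _)) by lra.
      pose proof (div_pow2_le_1 (Rabs w) N (Rabs_pos w)). unfold Rdiv in *. lra. }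
    rewrite mask_near by (rewrite Rabs_half; lra).
    replace (2 * (v / 2)) with v by field.
    destruct (Rle_dec (Rabs v) (4 * w0)) as [H1|H1].
    + rewrite (phiM_center (v / 2)) by (rewrite Rabs_half; lra). ring.
    + rewrite (phiM_far v) by lra. ring.
Qed.

(** The sequence is eventually constant, since [phiM (w / 2 ^ N)] is 1 for large [N]. *)
Lemma pprod_mask_lim w : Rabs w <= 2 * PI ->
  is_lim_seq (fun N => pprod (fun j => mask (w / 2 ^ j)) N) (phiM w).
Proof.
  intros Hw. pose proof PI2_3_2.
  destruct (inv_pow2_small (2 * w0) (Rabs w)) as [N HN]; [lra|].
  apply (is_lim_seq_ext_loc (fun _ => phiM w)); [|apply is_lim_seq_const].
  exists N. intros n Hn. rewrite <- (pprod_mask w n Hw), phiM_center; [ring|].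
  left. unfold Rdiv. pose proof (Rinv_0_lt_compat _ (pow2_pos n)).
  rewrite Rabs_mult, (Rabs_pos_eq (/ _)) by lra. now apply HN.
Qed.

(** The integrand equals 1 on $[-1,1]$, because $2\omega_0>1$, so every wide integral is at least
    2. *)
Lemma L2sq_phiM_pos : 0 < L2sq phiM.
Proof.
  pose proof PI2_3_2.
  assert (Hc : forall x, continuous (fun w => Rabs (phiM w) ^ 2) x).
  { intros x. apply continuous_ext with (fun w => phiM w * phiM w).
    - intros w. rewrite pow2_abs. exact (Rsqr_pow2 (phiM w)).
    - apply (continuous_mult phiM phiM); apply continuous_phiM. }
  destruct (ex_RIntR_decay (fun w : R => Rabs (phiM w) ^ 2) 40 Hc) as [L HL].
  { intros x. rewrite pow2_abs. apply phiM_sq_decay. }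
  unfold L2sq. rewrite (RIntR_unique _ _ HL).
  assert (2 <= L <= 40 * PI) as [H2 _]; [|lra].
  apply (is_RIntR_between (fun w => Rabs (phiM w) ^ 2)); [|exact HL].
  intros a b Ha Hb. split.
  - assert (Pos : forall c d, c <= d -> 0 <= RInt (fun w => Rabs (phiM w) ^ 2) c d).
    { intros c d Hcd. apply RInt_ge_0; [exact Hcd|now apply ex_RInt_of_continuous|].
      intros x _. apply pow2_ge_0. }
    assert (One : RInt (fun w => Rabs (phiM w) ^ 2) (-1) 1 = 2).
    { rewrite (RInt_ext _ (fun _ => 1)).
      - rewrite RInt_const. change ((1 - -1) * 1 = 2). ring.
      - intros x Hx. rewrite Rmin_left, Rmax_right in Hx by lra.
        rewrite phiM_center; [rewrite Rabs_R1; apply pow1|]. apply Rabs_le. lra. }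
    assert (Ch : RInt (fun w => Rabs (phiM w) ^ 2) a b
      = RInt (fun w => Rabs (phiM w) ^ 2) a (-1) + RInt (fun w => Rabs (phiM w) ^ 2) (-1) 1
        + RInt (fun w => Rabs (phiM w) ^ 2) 1 b).
    { rewrite <- (RInt_Chasles (V := R_CompleteNormedModule) _ a 1 b)
        by now apply ex_RInt_of_continuous.
      rewrite <- (RInt_Chasles (V := R_CompleteNormedModule) _ a (-1) 1)
        by now apply ex_RInt_of_continuous.
      reflexivity. }
    rewrite Ch, One. pose proof (Pos a (-1) Ha). pose proof (Pos 1 b Hb). lra.
  - eapply Rle_trans; [apply Rle_abs|].
    eapply Rle_trans; [apply (abs_RInt_le_atan _ 40); [exact Hc| |lra]|].
    + intros x. rewrite pow2_abs. apply phiM_sq_decay.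
    + pose proof (atan_bound a). pose proof (atan_bound b). lra.
Qed.
End Meyer.

(** * Fourier partial sums *)

(** Continuity on the compact interval makes the supremum finite; [real] of an infinite one would be
    the default 0. *)
Lemma supC_ge f x : (forall y, - PI <= y <= PI -> continuous f y) ->
  - PI <= x <= PI -> Rabs (f x) <= supC f.
Proof.
  intros Hf Hx. unfold supC.
  set (S := fun y => exists x, - PI <= x <= PI /\ y = Rabs (f x)).
  destruct (bounded_continuity (K := R_AbsRing) (V := R_NormedModule) f (- PI) PI Hf) as [M HM].
  pose proof (Lub_Rbar_correct S) as [Hub Hlub].
  assert (HS : S (Rabs (f x))) by (exists x; auto).
  assert (HM' : is_ub_Rbar S M).
  { intros y [z [Hz E]]. simpl. rewrite E. left. apply (HM z Hz). }
  specialize (Hlub _ HM'). specialize (Hub _ HS).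
  destruct (Lub_Rbar S); simpl in *; [exact Hub|contradiction|contradiction].
Qed.

Lemma is_derive_sum_n_m (a : nat -> R -> R) (da : nat -> R) N x :
  (forall k, is_derive (a k) x (da k)) ->
  is_derive (fun w => sum_n_m (fun k => a k w) 1 N) x (sum_n_m da 1 N).
Proof.
  intros H. induction N as [|N IH].
  - rewrite sum_n_m_zero by lia.
    apply is_derive_ext with (fun _ => zero); [|apply (is_derive_const (V := R_NormedModule))].
    intros t. now rewrite sum_n_m_zero by lia.
  - rewrite sum_n_Sm by lia.
    apply is_derive_ext with (fun w => plus (sum_n_m (fun k => a k w) 1 N) (a (S N) w)).
    + intros t. now rewrite sum_n_Sm by lia.
    + apply (is_derive_plus (V := R_NormedModule) (fun w => sum_n_m (fun k => a k w) 1 N)); auto.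
Qed.

Lemma RInt_by_parts_periodic (f df g dg : R -> R) a b : a <= b ->
  (forall x, a <= x <= b -> is_derive f x (df x)) ->
  (forall x, a <= x <= b -> continuous df x) ->
  (forall x, is_derive g x (dg x)) -> (forall x, continuous dg x) ->
  f b * g b = f a * g a ->
  RInt (fun t => df t * g t) a b = - RInt (fun t => f t * dg t) a b.
Proof.
  intros Hab Hf Hdf Hg Hdg E.
  assert (Cf : forall x, a <= x <= b -> continuous f x).
  { intros x Hx. apply (ex_derive_continuous f). eexists. now apply Hf. }
  assert (Cg : forall x, continuous g x).
  { intros x. apply (ex_derive_continuous g). eexists. now apply Hg. }
  assert (I1 : ex_RInt (fun t => df t * g t) a b).
  { apply (ex_RInt_continuous (V := R_CompleteNormedModule)).
    rewrite Rmin_left, Rmax_right by lra. intros x Hx. apply (continuous_mult df g); auto. }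
  assert (I2 : ex_RInt (fun t => f t * dg t) a b).
  { apply (ex_RInt_continuous (V := R_CompleteNormedModule)).
    rewrite Rmin_left, Rmax_right by lra. intros x Hx. apply (continuous_mult f dg); auto. }
  assert (H : is_RInt (fun t => df t * g t + f t * dg t) a b (f b * g b - f a * g a)).
  { apply (is_RInt_derive (V := R_CompleteNormedModule) (fun t => f t * g t)).
    - rewrite Rmin_left, Rmax_right by lra. intros x Hx.
      apply (is_derive_mult f g); auto. intros; apply Rmult_comm.
    - rewrite Rmin_left, Rmax_right by lra. intros x Hx.
      apply (continuous_plus (fun t => df t * g t) (fun t => f t * dg t)).
      + apply (continuous_mult df g); auto.
      + apply (continuous_mult f dg); auto. }
  apply (is_RInt_unique (V := R_CompleteNormedModule)) in H.
  pose proof (RInt_plus (V := R_CompleteNormedModule) _ _ a b I1 I2) as P.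
  change (RInt (fun t => df t * g t + f t * dg t) a b
    = RInt (fun t => df t * g t) a b + RInt (fun t => f t * dg t) a b) in P.
  simpl in *. lra.
Qed.

Lemma continuous_cos_mult a x : continuous (fun t => cos (a * t)) x.
Proof. apply (ex_derive_continuous (fun t => cos (a * t))). auto_derive. trivial. Qed.

Lemma continuous_sin_mult a x : continuous (fun t => sin (a * t)) x.
Proof. apply (ex_derive_continuous (fun t => sin (a * t))). auto_derive. trivial. Qed.

(** * Fourier coefficients of a derivative *)

Section FourierDerivative.
Variable f : R -> R.
Hypothesis f_deriv : forall x, - PI <= x <= PI -> ex_derive f x.
Hypothesis f_deriv_cont : forall x, - PI <= x <= PI -> continuous (Derive f) x.
Hypothesis f_left : f (- PI) = 0.
Hypothesis f_right : f PI = 0.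

Lemma four_a_Derive k : four_a (Derive f) k = INR k * four_b f k.
Proof.
  pose proof PI_RGT_0. unfold four_a, four_b.
  rewrite (RInt_by_parts_periodic f (Derive f) (fun t => cos (INR k * t))
    (fun t => - INR k * sin (INR k * t))).
  - rewrite (RInt_ext _ (fun t => scal (- INR k) (f t * sin (INR k * t)))).
    2:{ intros x _. unfold scal; simpl; unfold mult; simpl. unfold AbelianMonoid.sort; simpl. lra. }
    rewrite (RInt_scal (V := R_CompleteNormedModule)).
    + unfold scal; simpl; unfold mult; simpl. ring.
    + apply (ex_RInt_continuous (V := R_CompleteNormedModule)).
      rewrite Rmin_left, Rmax_right by lra. intros x Hx.
      apply (continuous_mult f (fun t => sin (INR k * t))).
      * now apply (ex_derive_continuous f), f_deriv.
      * apply continuous_sin_mult.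
  - lra.
  - intros x Hx. apply Derive_correct. auto.
  - exact f_deriv_cont.
  - intros x. auto_derive; [trivial|ring].
  - intros x. apply (continuous_mult (fun _ => - INR k)); [apply continuous_const|].
    apply continuous_sin_mult.
  - rewrite f_left, f_right. ring.
Qed.

Lemma four_b_Derive k : four_b (Derive f) k = - INR k * four_a f k.
Proof.
  pose proof PI_RGT_0. unfold four_a, four_b.
  rewrite (RInt_by_parts_periodic f (Derive f) (fun t => sin (INR k * t))
    (fun t => INR k * cos (INR k * t))).
  - rewrite (RInt_ext _ (fun t => scal (INR k) (f t * cos (INR k * t)))).
    2:{ intros x _. unfold scal; simpl; unfold mult; simpl. unfold AbelianMonoid.sort; simpl. lra. }
    rewrite (RInt_scal (V := R_CompleteNormedModule)).
    + unfold scal; simpl; unfold mult; simpl. ring.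
    + apply (ex_RInt_continuous (V := R_CompleteNormedModule)).
      rewrite Rmin_left, Rmax_right by lra. intros x Hx.
      apply (continuous_mult f (fun t => cos (INR k * t))).
      * now apply (ex_derive_continuous f), f_deriv.
      * apply continuous_cos_mult.
  - lra.
  - intros x Hx. apply Derive_correct. auto.
  - exact f_deriv_cont.
  - intros x. auto_derive; [trivial|ring].
  - intros x. apply (continuous_mult (fun _ => INR k)); [apply continuous_const|].
    apply continuous_cos_mult.
  - rewrite f_left, f_right. ring.
Qed.

(** Multipliers commute with differentiation: the coefficients of $f'$ are $kb_k$ and $-ka_k$,
    without boundary terms because $f(\pm\pi)=0$. The constant term of $f'$ carries $k=0$ and drops
    out. *)
Lemma is_derive_usum lam n w : is_derive (usum lam n f) w (usum lam n (Derive f) w).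
Proof.
  unfold usum. rewrite four_a_Derive. simpl (INR 0).
  apply (is_derive_plus (V := R_NormedModule) (fun _ => four_a f 0 / 2)).
  - replace (0 * four_b f 0 / 2) with 0 by field. apply (is_derive_const (V := R_NormedModule)).
  - apply (is_derive_sum_n_m
      (fun k w => lam n k * (four_a f k * cos (INR k * w) + four_b f k * sin (INR k * w)))).
    intros k. rewrite four_a_Derive, four_b_Derive. auto_derive; [trivial|ring].
Qed.
End FourierDerivative.

Lemma ex_derive_usum lam n f w : ex_derive (usum lam n f) w.
Proof.
  unfold usum. eexists.
  apply (is_derive_plus (V := R_NormedModule) (fun _ => four_a f 0 / 2)).
  - apply (is_derive_const (V := R_NormedModule)).
  - apply (is_derive_sum_n_m
      (fun k w => lam n k * (four_a f k * cos (INR k * w) + four_b f k * sin (INR k * w)))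
      (fun k => lam n k * (four_a f k * (- INR k * sin (INR k * w))
                           + four_b f k * (INR k * cos (INR k * w))))).
    intros k. auto_derive; [trivial|ring].
Qed.

Lemma continuous_usum lam n f w : continuous (usum lam n f) w.
Proof. apply (ex_derive_continuous (usum lam n f)), ex_derive_usum. Qed.

Lemma usum_shift_Z lam n f (p : Z) w : usum lam n f (w + 2 * PI * IZR p) = usum lam n f w.
Proof.
  unfold usum. f_equal. apply sum_n_m_ext. intros k.
  replace (INR k * (w + 2 * PI * IZR p)) with (INR k * w + 2 * PI * IZR (Z.of_nat k * p)).
  - now rewrite cos_shift_Z, sin_shift_Z.
  - rewrite mult_IZR, <- INR_IZR_INZ. ring.
Qed.

(** * The mask error *)

Lemma locally_Rabs_lt x r : Rabs x < r -> locally x (fun w => Rabs w < r).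
Proof.
  intros H. exists (mkposreal (r - Rabs x) ltac:(lra)). intros y Hy.
  change (Rabs (y - x) < r - Rabs x) in Hy.
  replace y with ((y - x) + x) by ring. eapply Rle_lt_trans; [apply Rabs_triang|]. lra.
Qed.

Lemma locally_Rabs_gt x r : r < Rabs x -> locally x (fun w => r < Rabs w).
Proof.
  intros H. exists (mkposreal (Rabs x - r) ltac:(lra)). intros y Hy.
  change (Rabs (y - x) < Rabs x - r) in Hy.
  pose proof (Rabs_triang_inv x y) as T. rewrite Rabs_minus_sym in T. lra.
Qed.

Lemma cos_half_pos x : Rabs x < PI -> 0 < cos (x / 2).
Proof. intros H. apply Rabs_def2 in H. apply cos_gt_0; lra. Qed.

Lemma pow_le_1 x n : 0 <= x <= 1 -> x ^ n <= 1.
Proof. intros H. pose proof (pow_incr x 1 n H) as P. now rewrite pow1 in P. Qed.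

Lemma cos_half_pow_bound l w : 0 <= cos (w / 2) ^ (2 * l) <= 1.
Proof.
  rewrite cos_half_pow. pose proof (hsin2_bound w). split; [apply pow_le; lra|].
  apply pow_le_1. lra.
Qed.

Section Mask.
Variables (theta : R -> R) (w0 : R).
Hypothesis theta_odd : odd_fun theta.
Hypothesis theta_incr : nondecr theta.
Hypothesis theta_C2 : C2fun theta.
Hypothesis theta_far : forall w, w > PI / 3 -> theta w = PI / 4.
Hypothesis w0_bound : PI / 3 <= w0 < PI / 2.

Notation phiM := (meyer_phi_hat theta w0).
Notation mask := (meyer_mask theta w0).
Notation f := (mMl theta w0).

Lemma is_derive_mMl_inside l x : Rabs x < PI ->
  is_derive (f l) x
    (2 * Derive phiM (2 * x) * / cos (x / 2) ^ (2 * l)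
     + phiM (2 * x) * (INR (2 * l) * sin (x / 2) / 2 * cos (x / 2) ^ pred (2 * l)
                       / (cos (x / 2) ^ (2 * l)) ^ 2)).
Proof.
  intros Hx. pose proof PI_RGT_0.
  apply is_derive_ext_loc with (fun w => phiM (2 * w) * / cos (w / 2) ^ (2 * l)).
  { generalize (locally_Rabs_lt x PI Hx). apply filter_imp. intros w Hw.
    unfold mMl. rewrite (mask_near theta w0) by (auto; lra). reflexivity. }
  pose proof (pow_lt _ (2 * l) (cos_half_pos x Hx)) as Hc.
  (* An opaque exponent makes [auto_derive] keep the power rule in its [pred] form. *)
  generalize dependent (2 * l)%nat. intros q Hc.
  assert (Ex : ex_derive phiM (2 * x)).
  { eexists. now apply is_derive_phiM. }
  auto_derive.
  - split; [exact Ex|]. split; [|trivial]. unfold Rdiv in Hc. simpl in Hc |- *. lra.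
  - change (Derive (fun x => phiM x)) with (Derive phiM).
    unfold Rdiv in *. set (C := cos (x * / 2) ^ q) in *. field. lra.
Qed.

(** This includes $\pm\pi$, where the cosine is 0: the numerator is 0, and the product is 0 whatever
    the inverse of 0 denotes. *)
Lemma mMl_far l w : PI - w0 < Rabs w < PI + w0 -> f l w = 0.
Proof.
  intros [H1 H2]. unfold mMl. rewrite (mask_near theta w0) by auto.
  rewrite (phiM_far theta w0); auto; [unfold Rdiv; ring|].
  rewrite Rabs_mult, Rabs_pos_eq; lra.
Qed.

Lemma is_derive_mMl_far l x : PI - w0 < Rabs x < PI + w0 -> is_derive (f l) x 0.
Proof.
  intros [H1 H2]. apply is_derive_ext_loc with (fun _ => 0).
  - generalize (filter_and _ _ (locally_Rabs_gt _ _ H1) (locally_Rabs_lt _ _ H2)).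
    apply filter_imp. intros w Hw. symmetry. now apply mMl_far.
  - apply (is_derive_const (V := R_NormedModule)).
Qed.

(** Two overlapping charts: the quotient formula for $|x|<\pi$, and the zero function around
    $\pm\pi$, where the denominator vanishes. *)
Lemma mMl_C1 l x : - PI <= x <= PI -> ex_derive (f l) x /\ continuous (Derive (f l)) x.
Proof.
  intros Hx. pose proof PI_RGT_0.
  assert (Hx' : Rabs x <= PI) by (apply Rabs_le; lra).
  destruct (Rlt_dec (Rabs x) PI) as [H1|H1].
  - split; [eexists; now apply is_derive_mMl_inside|].
    eapply continuous_ext_loc.
    { generalize (locally_Rabs_lt x PI H1). apply filter_imp. intros w Hw.
      symmetry. apply is_derive_unique, is_derive_mMl_inside, Hw. }
    pose proof (cos_half_pos x H1) as Hc. pose proof (pow_lt _ (2 * l) Hc) as Hcl.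
    assert (Hc2 : 0 < (cos (x / 2) ^ (2 * l)) ^ 2) by now apply pow_lt.
    assert (M : continuous (fun w : R => 2 * w) x).
    { apply (ex_derive_continuous (fun w => 2 * w)). auto_derive. trivial. }
    apply (continuous_plus (fun x => 2 * Derive phiM (2 * x) * / cos (x / 2) ^ (2 * l))
      (fun x => phiM (2 * x) * (INR (2 * l) * sin (x / 2) / 2 * cos (x / 2) ^ pred (2 * l)
                       / (cos (x / 2) ^ (2 * l)) ^ 2))).
    + apply (continuous_mult (fun x => 2 * Derive phiM (2 * x)) (fun x => / cos (x / 2) ^ (2 * l))).
      * apply (continuous_mult (fun _ => 2) (fun x => Derive phiM (2 * x))).
        { apply continuous_const. }
        apply (continuous_comp (fun w => 2 * w) (Derive phiM)); [exact M|].
        now apply continuous_Derive_phiM.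
      * apply (ex_derive_continuous (fun x => / cos (x / 2) ^ (2 * l))). auto_derive.
        unfold Rdiv in Hcl. simpl in Hcl |- *. lra.
    + apply (continuous_mult (fun x => phiM (2 * x))
        (fun x => INR (2 * l) * sin (x / 2) / 2 * cos (x / 2) ^ pred (2 * l)
                       / (cos (x / 2) ^ (2 * l)) ^ 2)).
      * apply (continuous_comp (fun w => 2 * w) phiM); [exact M|]. now apply continuous_phiM.
      * set (p := pred (2 * l)). set (q := (2 * l)%nat) in *.
        apply (ex_derive_continuous (fun x => INR q * sin (x / 2) / 2 * cos (x / 2) ^ p
                       / (cos (x / 2) ^ q) ^ 2)). auto_derive.
        unfold Rdiv in Hc2. simpl in Hc2 |- *. lra.
  - assert (Hf : PI - w0 < Rabs x < PI + w0) by lra. split; [eexists; now apply is_derive_mMl_far|].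
    apply continuous_ext_loc with (fun _ => 0); [|apply continuous_const].
    generalize (filter_and _ _ (locally_Rabs_gt _ _ (proj1 Hf)) (locally_Rabs_lt _ _ (proj2 Hf))).
    apply filter_imp. intros w Hw. symmetry. now apply is_derive_unique, is_derive_mMl_far.
Qed.

Lemma mMl_shift_Z l (n : Z) w : f l (w + 2 * PI * IZR n) = f l w.
Proof.
  unfold mMl. rewrite (mask_shift_Z theta w0), !cos_half_pow, hsin2_shift_Z by auto. reflexivity.
Qed.

(** At odd multiples of $\pi$ the division degenerates, but these points lie in the window, where
    the mask is 0. *)
Lemma cos_mMl l w : cos (w / 2) ^ (2 * l) * f l w = mask w.
Proof.
  unfold mMl. rewrite cos_half_pow. pose proof (hsin2_bound w) as Hb.
  destruct (Req_dec (hsin2 w) 1) as [H|H].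
  - rewrite (mask_window theta w0); auto; [unfold Rdiv; ring|].
    pose proof (meyer_tau_bound w0 w0_bound). lra.
  - field. apply pow_nonzero. lra.
Qed.

Variables (lam : nat -> nat -> R) (nl : nat -> nat).
Notation u := (ul theta w0 lam nl).
Notation al := (alpha theta w0 lam nl).
Notation ga := (gamma theta w0 lam nl).
Notation muM := (mu theta w0 lam nl).
Notation m := (ml theta w0 lam nl).

Lemma mMl_boundary l : f l (- PI) = 0 /\ f l PI = 0.
Proof.
  pose proof PI_RGT_0. split; apply mMl_far; [rewrite Rabs_left|rewrite Rabs_pos_eq]; lra.
Qed.

Lemma is_derive_ul l w : is_derive (u l) w (u1l theta w0 lam nl l w).
Proof.
  apply is_derive_usum.
  - intros x Hx. now apply mMl_C1.
  - intros x Hx. now apply mMl_C1.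
  - apply mMl_boundary.
  - apply mMl_boundary.
Qed.

(** [alpha] is a supremum over one period. Both functions are periodic, [mMl] because the exponent
    of the cosine is even. *)
Lemma ul_alpha l w : Rabs (u l w - f l w) <= al l.
Proof.
  destruct (red2pi_decomp w) as [Hr [n E]]. rewrite E at 1 2.
  unfold ul. rewrite usum_shift_Z, mMl_shift_Z.
  apply (supC_ge (fun w => u l w - f l w)); [|lra].
  intros y Hy. apply (continuous_minus (u l) (f l)).
  - apply continuous_usum.
  - apply (ex_derive_continuous (f l)). now apply mMl_C1.
Qed.

Lemma u1l_gamma l w : - PI <= w <= PI ->
  Rabs (u1l theta w0 lam nl l w - Derive (f l) w) <= ga l.
Proof.
  intros Hw. apply (supC_ge (fun w => u1l theta w0 lam nl l w - Derive (f l) w)); [|exact Hw].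
  intros y Hy. apply (continuous_minus (u1l theta w0 lam nl l) (Derive (f l))).
  - apply continuous_usum.
  - now apply mMl_C1.
Qed.

Lemma alpha_pos l : 0 <= al l.
Proof. eapply Rle_trans; [apply Rabs_pos|apply (ul_alpha l 0)]. Qed.

Lemma gamma_pos l : 0 <= ga l.
Proof.
  pose proof PI_RGT_0.
  eapply Rle_trans; [apply Rabs_pos|apply (u1l_gamma l 0)]. lra.
Qed.

Lemma alpha_le_mu l : (1 <= l)%nat -> al l <= muM l.
Proof.
  intros H. unfold mu. pose proof (alpha_pos l). pose proof (gamma_pos l).
  apply le_INR in H. simpl in H. nra.
Qed.

Lemma mMl_0 l : f l 0 = 1.
Proof.
  pose proof (cos_mMl l 0) as H. rewrite (mask_center theta w0) in H; auto.
  - replace (0 / 2) with 0 in H by field. rewrite cos_0, pow1 in H. lra.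
  - pose proof PI_RGT_0. rewrite Rabs_R0. lra.
Qed.

(** Mean value theorem for $\cos(w/2)^{2l}(u_l-m^M_l)$: differentiating the power costs $l\alpha$,
    the exponent $2l$ meeting the inner $1/2$, and differentiating the difference costs $\gamma$.
    Their sum is [mu]. *)
Lemma center_increment l w : Rabs w <= 1 ->
  Rabs (cos (w / 2) ^ (2 * l) * (u l w - f l w) - (u l 0 - f l 0)) <= muM l * Rabs w.
Proof.
  intros Hw. pose proof PI2_3_2.
  set (h := fun w => cos (w / 2) ^ (2 * l) * (u l w - f l w)).
  set (dh := fun w => (INR (2 * l) * (- sin (w / 2) / 2) * cos (w / 2) ^ pred (2 * l))
                       * (u l w - f l w)
             + cos (w / 2) ^ (2 * l) * (u1l theta w0 lam nl l w - Derive (f l) w)).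
  assert (Hin : forall x, Rmin 0 w <= x <= Rmax 0 w -> - PI <= x <= PI).
  { intros x Hx. apply Rabs_le_between in Hw.
    pose proof (Rmin_glb 0 w (-1) ltac:(lra) ltac:(lra)).
    pose proof (Rmax_lub 0 w 1 ltac:(lra) ltac:(lra)). lra. }
  assert (Hd : forall x, - PI <= x <= PI -> is_derive h x (dh x)).
  { intros x Hx.
    apply (is_derive_mult (fun w => cos (w / 2) ^ (2 * l)) (fun w => u l w - f l w)).
    - generalize (2 * l)%nat as q. intros q. auto_derive; [trivial|]. unfold Rdiv. ring.
    - apply (is_derive_minus (V := R_NormedModule) (u l) (f l)).
      + apply is_derive_ul.
      + apply Derive_correct. now apply mMl_C1.
    - intros; apply Rmult_comm. }
  destruct (MVT_gen h 0 w dh) as [c [Hc E]].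
  { intros x Hx. apply Hd, Hin. lra. }
  { intros x Hx. apply continuity_pt_filterlim. apply (ex_derive_continuous h).
    eexists. now apply Hd, Hin. }
  assert (E0 : h 0 = u l 0 - f l 0).
  { unfold h. replace (0 / 2) with 0 by field. rewrite cos_0, pow1. ring. }
  fold (h w). rewrite <- E0, E, Rminus_0_r, Rabs_mult.
  apply Rmult_le_compat_r; [apply Rabs_pos|].
  unfold dh. eapply Rle_trans; [apply Rabs_triang|]. rewrite !Rabs_mult.
  unfold mu. apply Rplus_le_compat.
  - apply Rmult_le_compat; auto using Rabs_pos, ul_alpha.
    + repeat apply Rmult_le_pos; apply Rabs_pos.
    + assert (S1 : Rabs (- sin (c / 2) / 2) <= / 2).
      { unfold Rdiv. rewrite Rabs_mult, Rabs_Ropp, (Rabs_pos_eq (/ 2)) by lra.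
        pose proof (SIN_bound (c / 2)) as Hs. apply Rabs_le in Hs. lra. }
      assert (S2 : Rabs (cos (c / 2) ^ pred (2 * l)) <= 1).
      { rewrite <- RPow_abs. apply pow_le_1.
        split; [apply Rabs_pos|]. apply Rabs_le, COS_bound. }
      rewrite (Rabs_pos_eq (INR _)) by apply pos_INR.
      replace (INR l) with (INR (2 * l) * / 2 * 1) by (rewrite mult_INR; simpl; field).
      pose proof (pos_INR (2 * l)).
      apply Rmult_le_compat; auto using Rabs_pos.
      * apply Rmult_le_pos; auto using Rabs_pos.
      * now apply Rmult_le_compat_l.
  - rewrite <- (Rmult_1_l (ga l)). apply Rmult_le_compat; auto using Rabs_pos, u1l_gamma.
    rewrite Rabs_pos_eq; apply cos_half_pow_bound.
Qed.

(** * The approximate mask when the error is at most 1/4 *)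

Section SmallError.
Variable l : nat.
Hypothesis l_ge : (3 <= l)%nat.
Hypothesis mu_small : muM l <= 1 / 4.

Lemma al_small : al l <= 1 / 4.
Proof. eapply Rle_trans; [apply alpha_le_mu; lia|exact mu_small]. Qed.

Lemma mu_pos : 0 <= muM l.
Proof. eapply Rle_trans; [apply (alpha_pos l)|apply alpha_le_mu; lia]. Qed.

Lemma ul_0_bound : 1 - al l <= u l 0.
Proof.
  pose proof (ul_alpha l 0) as H. rewrite mMl_0 in H. apply Rabs_le_between in H. lra.
Qed.

Lemma div_ul_0 x b : Rabs x <= b -> Rabs (x / u l 0) <= 2 * b.
Proof.
  intros H. pose proof ul_0_bound. pose proof al_small. unfold Rdiv.
  rewrite Rabs_mult, (Rabs_pos_eq (/ _)) by (left; apply Rinv_0_lt_compat; lra).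
  assert (/ u l 0 <= / (1 / 2)) by (apply Rinv_le_contravar; lra).
  rewrite (Rmult_comm 2). apply Rmult_le_compat; auto using Rabs_pos.
  - left; apply Rinv_0_lt_compat; lra.
  - lra.
Qed.

(** As $m^M_l(0)=1$, the normalization contributes exactly [u l 0 - f l 0]. Where the mask is 1, the
    numerator is the increment from 0 of a single function. *)
Lemma ml_minus_mask w : m l w - mask w =
  (cos (w / 2) ^ (2 * l) * (u l w - f l w) - (u l 0 - f l 0) * mask w) / u l 0.
Proof.
  pose proof ul_0_bound. pose proof al_small.
  unfold ml. rewrite mMl_0, <- (cos_mMl l w). field. lra.
Qed.

Lemma cos_error_le w : Rabs (cos (w / 2) ^ (2 * l) * (u l w - f l w)) <= al l.
Proof.
  pose proof (cos_half_pow_bound l w). pose proof (ul_alpha l w). pose proof (alpha_pos l).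
  rewrite Rabs_mult, Rabs_pos_eq by lra. pose proof (Rabs_pos (u l w - f l w)). nra.
Qed.

(** For $|w|\le1<\omega_0$ the mask is 1 and the increment bound applies; for $|w|>1$ the uniform
    bound [4 * al] suffices, as $\alpha\le\mu$. *)
Lemma ml_mask_close w : Rabs (m l w - mask w) <= 4 * muM l * Rabs w.
Proof.
  pose proof PI2_3_2. rewrite ml_minus_mask.
  destruct (Rle_dec (Rabs w) 1) as [Hw|Hw].
  - rewrite (mask_center theta w0), Rmult_1_r by (auto; lra).
    eapply Rle_trans; [apply div_ul_0, center_increment, Hw|].
    assert (0 <= muM l * Rabs w) by (apply Rmult_le_pos; auto using mu_pos, Rabs_pos). lra.
  - eapply Rle_trans; [apply (div_ul_0 _ (2 * al l))|].
    + eapply Rle_trans; [apply Rabs_triang|]. rewrite Rabs_Ropp, (Rabs_mult _ (mask w)).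
      pose proof (cos_error_le w). pose proof (ul_alpha l 0).
      pose proof (mask_bound theta w0 theta_odd theta_incr theta_C2 theta_far w0_bound w).
      rewrite (Rabs_pos_eq (mask w)) by lra.
      pose proof (Rabs_pos (u l 0 - f l 0)). nra.
    + pose proof (alpha_le_mu l ltac:(lia)). pose proof mu_pos. nra.
Qed.

(** The extreme value is $(1+1/4)/(3/4)=5/3$. *)
Lemma ml_le_2 w : Rabs (m l w) <= 2.
Proof.
  pose proof ul_0_bound. pose proof al_small. pose proof (alpha_pos l).
  pose proof (cos_error_le w) as He.
  pose proof (mask_bound theta w0 theta_odd theta_incr theta_C2 theta_far w0_bound w).
  replace (m l w) with ((mask w + cos (w / 2) ^ (2 * l) * (u l w - f l w)) / u l 0).
  2:{ unfold ml. rewrite <- (cos_mMl l w). field. lra. }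
  apply Rabs_le_between in He.
  apply Rabs_le. split.
  - apply Rle_div_r; lra.
  - apply Rle_div_l; lra.
Qed.

(** The mask vanishes here, so only the error term remains. Of its factor $(1-t)^l$ just the cube
    matched to the weight is kept, which asks for $l\ge3$. *)
Lemma ml_window w : meyer_tau w0 <= hsin2 w -> Rabs (m l w) <= 2 * al l * (1 - hsin2 w) ^ 3.
Proof.
  intros Hw. pose proof ul_0_bound. pose proof al_small. pose proof (alpha_pos l).
  assert (E : m l w = (cos (w / 2) ^ (2 * l) * (u l w - f l w)) / u l 0).
  { unfold ml. rewrite Rmult_minus_distr_l, cos_mMl, (mask_window theta w0) by auto.
    field. lra. }
  rewrite E, Rmult_assoc. apply div_ul_0. rewrite Rabs_mult, (Rmult_comm (al l)).
  apply Rmult_le_compat; auto using Rabs_pos, ul_alpha.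
  pose proof (hsin2_bound w).
  rewrite Rabs_pos_eq by apply cos_half_pow_bound. rewrite cos_half_pow.
  replace l with (3 + (l - 3))%nat by lia. rewrite pow_add.
  apply Rle_trans with ((1 - hsin2 w) ^ 3 * 1); [|lra].
  apply Rmult_le_compat_l; [apply pow_le; lra|].
  apply pow_le_1. lra.
Qed.

Lemma ml_near_1 v : Rabs (m l v - 1) <= 5 * Rabs v.
Proof.
  pose proof (ml_mask_close v).
  pose proof (mask_near_1 theta w0 theta_odd theta_incr theta_C2 theta_far w0_bound v).
  replace (m l v - 1) with ((m l v - mask v) + (mask v - 1)) by ring.
  eapply Rle_trans; [apply Rabs_triang|].
  pose proof (Rabs_pos v). nra.
Qed.

Lemma continuous_ml x : continuous (m l) x.
Proof.
  unfold ml.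
  apply (continuous_mult (fun w => cos (w / 2) ^ (2 * l) * u l w) (fun _ => / u l 0)).
  - apply (continuous_mult (fun w => cos (w / 2) ^ (2 * l)) (u l)).
    + apply (ex_derive_continuous (fun w => cos (w / 2) ^ (2 * l))). auto_derive. trivial.
    + apply continuous_usum.
  - apply continuous_const.
Qed.
End SmallError.
End Mask.

(** * The orthogonalized scaling function *)

Lemma decay_sq_weaken A x : 0 <= A -> A / (1 + x ^ 2) ^ 2 <= A / (1 + x ^ 2).
Proof.
  intros HA. unfold Rdiv. apply Rmult_le_compat_l; [exact HA|].
  pose proof (pow2_ge_0 x). apply Rinv_le_contravar; nra.
Qed.

(** The exponential bounds the partial products on $|w|\le2\pi$ for slope 5 at the origin;
    $2080=8\cdot4\cdot65$ bounds $8\pi(1+w^2)$ there and covers the tail constant 2000. *)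
Definition cst_phi : R := 2080 * exp (5 * (2 * PI)).
(** The second factor bounds the sum of the two functions: 40 for [phiM], [40 + cst_phi] for
    [phil_hat]. *)
Definition cst_sq : R := cst_phi * (80 + cst_phi).
(** $264=66\cdot4$ dominates the factor $66\pi$ of [bracket_bound]. *)
Definition cst_Phi : R := 264 * cst_sq.
(** The outer 2 bounds $1/\Phi_l$, and $1600=40^2$ comes from the decay of the squared Meyer
    function. *)
Definition cst_perp : R := 2 * (cst_sq + 1600 * cst_Phi).

Lemma cst_phi_pos : 0 < cst_phi.
Proof. unfold cst_phi. pose proof (exp_pos (5 * (2 * PI))). lra. Qed.

Lemma cst_sq_pos : 0 < cst_sq.
Proof. pose proof cst_phi_pos. unfold cst_sq. nra. Qed.

Section Assembly.
Variables (theta : R -> R) (w0 : R) (lam : nat -> nat -> R) (nl : nat -> nat) (l : nat).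
Hypothesis theta_odd : odd_fun theta.
Hypothesis theta_incr : nondecr theta.
Hypothesis theta_C2 : C2fun theta.
Hypothesis theta_far : forall w, w > PI / 3 -> theta w = PI / 4.
Hypothesis w0_bound : PI / 3 <= w0 < PI / 2.
Hypothesis l_ge : (3 <= l)%nat.

Notation phiM := (meyer_phi_hat theta w0).
Notation mask := (meyer_mask theta w0).
Notation m := (ml theta w0 lam nl l).
Notation phi := (phil_hat theta w0 lam nl l).
Notation Phi := (Phil theta w0 lam nl l).
Notation muM := (mu theta w0 lam nl l).

Hypothesis mu_small : muM <= 1 / 4.

Lemma mu_nonneg : 0 <= muM.
Proof. now apply mu_pos. Qed.

Lemma phil_close w : Rabs (phi w - phiM w) <= cst_phi * muM / (1 + w ^ 2).
Proof.
  pose proof mu_nonneg as Hmu. pose proof PI_RGT_0 as Hpi. pose proof PI_4 as Hpi4.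
  pose proof (one_plus_sq_pos w) as Pw.
  set (E := exp (5 * (2 * PI))). assert (HE : 0 < E) by apply exp_pos.
  assert (N1 : forall v, Rabs (m v - 1) <= 5 * Rabs v) by (intros v; now apply ml_near_1).
  change phi with (iprod m).
  destruct (Rle_dec (Rabs w) (2 * PI)) as [Hw|Hw].
  - assert (H : Rabs (iprod m w - phiM w) <= E * (2 * PI) * (4 * muM)).
    { apply (iprod_compare m 5) with mask; auto; try lra.
      - intros v.
        pose proof (mask_bound theta w0 theta_odd theta_incr theta_C2 theta_far w0_bound v).
        rewrite Rabs_pos_eq; lra.
      - intros v. now apply ml_mask_close.
      - now apply pprod_mask_lim. }
    eapply Rle_trans; [exact H|]. apply (Rle_div_r _ _ (1 + w ^ 2)); [lra|].
    assert (w ^ 2 <= 64).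
    { rewrite <- pow2_abs. pose proof (Rabs_pos w). nra. }
    unfold cst_phi. fold E.
    replace (E * (2 * PI) * (4 * muM) * (1 + w ^ 2))
      with (E * muM * (8 * (PI * (1 + w ^ 2)))) by ring.
    replace (2080 * E * muM) with (E * muM * (8 * 260)) by ring.
    apply Rmult_le_compat_l; [apply Rmult_le_pos; lra|]. nra.
  - rewrite (phiM_far theta w0) by (auto; lra). rewrite Rminus_0_r.
    pose proof (al_small theta w0 theta_odd theta_incr theta_C2 theta_far w0_bound lam nl
                  l l_ge mu_small) as Ha.
    pose proof (alpha_pos theta w0 theta_odd theta_incr theta_C2 theta_far w0_bound lam nl l) as Ha0.
    pose proof (alpha_le_mu theta w0 theta_odd theta_incr theta_C2 theta_far w0_bound lam nl l
                  ltac:(lia)) as Ham.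
    set (al := alpha theta w0 lam nl l) in *.
    assert (H : Rabs (iprod m w) <= 2000 * E * al / (1 + w ^ 2)).
    { apply (tail_bound m (iprod m) (meyer_tau w0) al E); try lra.
      - now apply meyer_tau_bound.
      - intros x. now apply ml_le_2.
      - intros x Hx. now apply ml_window.
      - intros x. apply (iprod_double m 5); auto; lra.
      - intros x Hx. apply (iprod_bounded m 5); auto; lra. }
    eapply Rle_trans; [exact H|]. unfold Rdiv. apply Rmult_le_compat_r.
    + left. now apply Rinv_0_lt_compat.
    + unfold cst_phi. fold E.
      assert (E * al <= E * muM) by (apply Rmult_le_compat_l; lra).
      assert (0 <= E * muM) by (apply Rmult_le_pos; lra). lra.
Qed.

Lemma phil_decay w : Rabs (phi w) <= (40 + cst_phi) / (1 + w ^ 2).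
Proof.
  pose proof (phil_close w) as H. pose proof cst_phi_pos.
  pose proof (phiM_decay theta w0 theta_odd theta_incr theta_C2 theta_far w0_bound w).
  pose proof (phiM_bound theta w0 theta_odd theta_incr theta_C2 theta_far w0_bound w).
  pose proof (Rinv_0_lt_compat _ (one_plus_sq_pos w)) as Pi.
  replace (phi w) with (phi w - phiM w + phiM w) by ring.
  eapply Rle_trans; [apply Rabs_triang|]. rewrite (Rabs_pos_eq (phiM w)) by lra.
  assert (cst_phi * muM / (1 + w ^ 2) <= cst_phi / (1 + w ^ 2)).
  { unfold Rdiv. apply Rmult_le_compat_r; [lra|]. pose proof mu_nonneg. nra. }
  unfold Rdiv in *. lra.
Qed.

Lemma phil_sq_close w :
  Rabs (phi w ^ 2 - phiM w ^ 2) <= cst_sq * muM / (1 + w ^ 2) ^ 2.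
Proof.
  pose proof (one_plus_sq_pos w) as Pw.
  replace (phi w ^ 2 - phiM w ^ 2) with ((phi w - phiM w) * (phi w + phiM w)) by ring.
  replace (cst_sq * muM / (1 + w ^ 2) ^ 2)
    with ((cst_phi * muM / (1 + w ^ 2)) * ((80 + cst_phi) / (1 + w ^ 2)))
    by (unfold cst_sq; field; lra).
  rewrite Rabs_mult. apply Rmult_le_compat; auto using Rabs_pos, phil_close.
  pose proof (phil_decay w).
  pose proof (phiM_decay theta w0 theta_odd theta_incr theta_C2 theta_far w0_bound w).
  pose proof (phiM_bound theta w0 theta_odd theta_incr theta_C2 theta_far w0_bound w).
  eapply Rle_trans; [apply Rabs_triang|]. rewrite (Rabs_pos_eq (phiM w)) by lra.
  unfold Rdiv in *. lra.
Qed.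

Lemma phil_sq_decay w : Rabs (phi w ^ 2) <= (40 + cst_phi) ^ 2 / (1 + w ^ 2).
Proof.
  eapply Rle_trans; [|apply decay_sq_weaken, pow2_ge_0].
  pose proof (one_plus_sq_pos w).
  rewrite <- RPow_abs. replace ((40 + cst_phi) ^ 2 / (1 + w ^ 2) ^ 2)
    with (((40 + cst_phi) / (1 + w ^ 2)) ^ 2) by (field; lra).
  apply pow_incr. split; [apply Rabs_pos|apply phil_decay].
Qed.

Lemma Phil_close w : Rabs (Phi w - 1) <= cst_Phi * muM.
Proof.
  pose proof PI_4. pose proof PI_RGT_0. pose proof cst_sq_pos. pose proof mu_nonneg.
  rewrite <- (bracket_phiM theta w0 theta_odd theta_incr theta_C2 theta_far w0_bound w).
  change (Phi w) with (bracket (fun v => phi v ^ 2) w).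
  rewrite (bracket_minus _ _ _ _ w phil_sq_decay
    (phiM_sq_decay theta w0 theta_odd theta_incr theta_C2 theta_far w0_bound)).
  assert (0 <= cst_sq * muM) by (apply Rmult_le_pos; lra).
  eapply Rle_trans; [apply (bracket_bound _ (cst_sq * muM))|].
  - intros v. eapply Rle_trans; [apply phil_sq_close|now apply decay_sq_weaken].
  - unfold cst_Phi. nra.
Qed.

Lemma continuous_phil_sq x : continuous (fun v => phi v ^ 2) x.
Proof.
  assert (C : continuous phi x).
  { apply (continuous_iprod m 5); [lra| |].
    - intros v. now apply ml_near_1.
    - intros v. now apply continuous_ml. }
  apply continuous_ext with (fun v => phi v * phi v).
  - intros v. exact (Rsqr_pow2 (phi v)).
  - now apply (continuous_mult phi phi).
Qed.

Hypothesis Phi_small : cst_Phi * muM <= 1 / 2.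

Lemma Phil_lower w : 1 / 2 <= Phi w.
Proof. pose proof (Phil_close w) as H. apply Rabs_le_between in H. lra. Qed.

Lemma perp_sq w : Rabs (phil_perp_hat theta w0 lam nl l w) ^ 2 = phi w ^ 2 / Phi w.
Proof.
  pose proof (Phil_lower w). rewrite pow2_abs. unfold phil_perp_hat.
  unfold Rdiv. rewrite Rpow_mult_distr, pow_inv, pow2_sqrt by lra. reflexivity.
Qed.

Lemma continuous_perp_sq x :
  continuous (fun w => Rabs (phil_perp_hat theta w0 lam nl l w) ^ 2) x.
Proof.
  apply continuous_ext with (fun w => phi w ^ 2 * / Phi w).
  - intros w. symmetry. apply perp_sq.
  - apply (continuous_mult (fun w => phi w ^ 2) (fun w => / Phi w)).
    + apply continuous_phil_sq.
    + apply continuous_Rinv_comp.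
      * apply (continuous_bracket (fun v => phi v ^ 2) _ phil_sq_decay).
        apply continuous_phil_sq.
      * pose proof (Phil_lower x). lra.
Qed.

Lemma perp_sq_close w :
  Rabs (Rabs (phil_perp_hat theta w0 lam nl l w) ^ 2 - Rabs (phiM w) ^ 2)
    <= cst_perp * muM / (1 + w ^ 2) ^ 2.
Proof.
  pose proof (Phil_lower w) as HP. pose proof (Phil_close w) as HC.
  pose proof (phil_sq_close w) as HS. pose proof cst_sq_pos as Hsq.
  pose proof (one_plus_sq_pos w) as Pw. pose proof mu_nonneg as Hmu.
  rewrite perp_sq, pow2_abs.
  (* Separates the error of the square from that of the periodization; the latter has no decay of
     its own and inherits it from [phiM w ^ 2]. *)
  replace (phi w ^ 2 / Phi w - phiM w ^ 2)
    with (((phi w ^ 2 - phiM w ^ 2) - phiM w ^ 2 * (Phi w - 1)) * / Phi w) by (field; lra).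
  rewrite Rabs_mult, (Rabs_pos_eq (/ _)) by (left; apply Rinv_0_lt_compat; lra).
  assert (HI : / Phi w <= / (1 / 2)) by (apply Rinv_le_contravar; lra).
  assert (HM : phiM w ^ 2 <= 1600 / (1 + w ^ 2) ^ 2).
  { replace (1600 / (1 + w ^ 2) ^ 2) with ((40 / (1 + w ^ 2)) ^ 2) by (field; lra).
    apply pow_incr. split; [now apply phiM_bound|now apply phiM_decay]. }
  replace (cst_perp * muM / (1 + w ^ 2) ^ 2)
    with ((cst_sq * muM / (1 + w ^ 2) ^ 2 + 1600 / (1 + w ^ 2) ^ 2 * (cst_Phi * muM)) * 2)
    by (unfold cst_perp; field; lra).
  apply Rmult_le_compat; [apply Rabs_pos|left; apply Rinv_0_lt_compat; lra| |lra].
  eapply Rle_trans; [apply Rabs_triang|]. rewrite Rabs_Ropp.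
  apply Rplus_le_compat; [exact HS|]. rewrite Rabs_mult.
  apply Rmult_le_compat; auto using Rabs_pos.
  rewrite Rabs_pos_eq; [exact HM|apply pow2_ge_0].
Qed.
End Assembly.

Theorem theorem3 (theta : R -> R) (w0 : R) (lam : nat -> nat -> R) (nl : nat -> nat) (l0 : nat) :
  odd_fun theta -> nondecr theta -> C2fun theta ->
  (forall w, w > PI / 3 -> theta w = PI / 4) ->
  PI / 3 <= w0 < PI / 2 ->
  is_lim_seq (fun l => INR l * alpha theta w0 lam nl l) 0 ->
  is_lim_seq (fun l => gamma theta w0 lam nl l) 0 ->
  (forall l, ul theta w0 lam nl l PI <> 0) ->
  Rbar_lt 0 (cinf theta w0 lam nl l0) ->
  exists K : R, exists N : nat, forall l : nat, (l0 <= l)%nat -> (N <= l)%nat ->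
    Rabs (freq_radius2 (phil_perp_hat theta w0 lam nl l)
          - freq_radius2 (meyer_phi_hat theta w0))
    <= K * Rmax (mu theta w0 lam nl l)
                (Rpower (4 * exp (2 * w0))
                   (- 2 * INR l
                    + 4 * (ln ((1 + eps theta w0 lam nl l) / real (cinf theta w0 lam nl l0)) / ln 2))).
Proof.
  intros Hodd Hinc HC2 Hfar Hw0 Hal Hga _ _.
  destruct (freq_radius2_stable (meyer_phi_hat theta w0) 1600) as [K [delta [HK [Hdelta Hst]]]].
  - intros w. apply continuous_ext with (fun w => meyer_phi_hat theta w0 w * meyer_phi_hat theta w0 w).
    + intros v. rewrite pow2_abs. exact (Rsqr_pow2 _).
    + apply (continuous_mult (meyer_phi_hat theta w0) (meyer_phi_hat theta w0));
        now apply continuous_phiM.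
  - intros w. rewrite pow2_abs. pose proof (one_plus_sq_pos w).
    replace (1600 / (1 + w ^ 2) ^ 2) with ((40 / (1 + w ^ 2)) ^ 2) by (field; lra).
    apply pow_incr. split; [now apply phiM_bound|now apply phiM_decay].
  - now apply L2sq_phiM_pos.
  - pose proof cst_sq_pos as Hsq.
    assert (HPhi : 0 < cst_Phi) by (unfold cst_Phi; lra).
    assert (Hperp : 0 < cst_perp) by (unfold cst_perp; lra).
    (* Three thresholds for [mu]: the mask estimates, $\Phi_l\ge1/2$, and the stability range of the
       radius. *)
    set (d := Rmin (1 / 4) (Rmin (/ (2 * cst_Phi)) (delta / cst_perp))).
    assert (Hd : 0 < d).
    { repeat apply Rmin_pos; [lra|apply Rinv_0_lt_compat; lra|now apply Rdiv_lt_0_compat]. }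
    assert (Hmu : is_lim_seq (fun l => mu theta w0 lam nl l) 0).
    { replace (Finite 0) with (Finite (0 + 0)) by (f_equal; ring).
      now apply is_lim_seq_plus'. }
    apply is_lim_seq_spec in Hmu. destruct (Hmu (mkposreal d Hd)) as [N HN].
    (* The shift by 3 secures $l\ge3$, needed for the cubic bound in the window. *)
    exists (K * cst_perp), (N + 3)%nat. intros l _ Hl.
    assert (Hml : mu theta w0 lam nl l <= d).
    { specialize (HN l ltac:(lia)). simpl in HN. rewrite Rminus_0_r in HN.
      left. eapply Rle_lt_trans; [apply Rle_abs|exact HN]. }
    assert (D1 : d <= 1 / 4) by apply Rmin_l.
    assert (D2 : d <= / (2 * cst_Phi)).
    { eapply Rle_trans; [apply Rmin_r|apply Rmin_l]. }
    assert (D3 : d <= delta / cst_perp).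
    { eapply Rle_trans; [apply Rmin_r|apply Rmin_r]. }
    set (M := mu theta w0 lam nl l) in *.
    assert (M1 : M <= 1 / 4) by lra.
    assert (M2 : cst_Phi * M <= 1 / 2).
    { apply Rle_trans with (cst_Phi * / (2 * cst_Phi)); [|right; field; lra].
      apply Rmult_le_compat_l; lra. }
    assert (M3 : cst_perp * M <= delta).
    { apply Rle_trans with (cst_perp * (delta / cst_perp)); [|right; field; lra].
      apply Rmult_le_compat_l; lra. }
    eapply Rle_trans.
    + apply (Hst _ (cst_perp * M) M3).
      * intros w. apply continuous_perp_sq; auto. lia.
      * intros w. apply perp_sq_close; auto. lia.
    + rewrite <- Rmult_assoc. apply Rmult_le_compat_l; [|apply Rmax_l].
      apply Rmult_le_pos; lra.
Qed.
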